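(* Let $k\geq 8$ be an integer, let $d_k<d<1$, where $$d_{k}=\begin{cases}\frac{1}{3}&\text{if }k\equiv 0 \bmod 3,\\ \frac{k+2}{3k}&\text{if }k\equiv 1 \bmod 3,\\ \frac{k+1}{3k}&\text{if }k\equiv 2\bmod 3,\end{cases}$$ and for each $m\ge 2$ let $\Gamma_{m}\sim \Gamma (m,k,d)$ be a random group in the strict $(m,k,d)$ model. Then $$\lim_{m\rightarrow\infty }\mathbb{P}(\Gamma_{m}\text{ has Property }(T))=1.$$
   Context: Strict $(n,k,d)$ model: for $n\ge 2$, $k\ge 3$, $0<d<1$, let $A_n=\{a_1,\dots,a_n\}$ and let $F_n$ be the free group on $A_n$. Let $\mathcal{C}(n,k)$ be the set of cyclically reduced words of length $k$ in $F_n$. Choose uniformly at random a subset $R\subseteq\mathcal{C}(n,k)$ of size $|R|=(2n-1)^{kd}$ (quantities that must be integers are implicitly replaced by their integer part), and let $\Gamma=\langle A_n\mid R\rangle$. One writes $\Gamma\sim\Gamma(n,k,d)$. Property (T): a finitely generated group $\Gamma$ with finite generating set $S$ has Property (T) if every unitary representation $\pi$ of $\Gamma$ on a Hilbert space $\mathcal{H}$ with almost-invariant vectors (for every $\epsilon>0$ there is a non-zero $u\in\mathcal{H}$ with $\|\pi(s)u-u\|<\epsilon\|u\|$ for all $s\in S$) has a non-zero invariant vector. *)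

(* Defs.v *)
From HB Require Import structures.
From mathcomp Require Import all_boot all_order all_algebra.
From mathcomp Require Import generic_quotient complex.
From mathcomp Require Import all_classical all_reals all_analysis.

Set Implicit Arguments.
Unset Strict Implicit.
Unset Printing Implicit Defensive.

Import Order.TTheory GRing.Theory Num.Theory numFieldNormedType.Exports.
Local Open Scope classical_set_scope.
Local Open Scope ring_scope.

(* The letter (a, true) stands for the generator a, (a, false) for its
   inverse. *)
Notation letter A := (A * bool)%type.
Notation word A := (seq (A * bool)).

Definition inv_letter {A : Type} (x : letter A) : letter A := (x.1, ~~ x.2).

Definition inv_word {A : Type} (w : word A) : word A :=
  rev (map inv_letter w).

Section Presentation.
Variables (A : choiceType) (rels : set (word A)).

Inductive word_eq : word A -> word A -> Prop :=
| word_eq_refl u : word_eq u u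
| word_eq_sym u v : word_eq u v -> word_eq v u
| word_eq_trans u v w : word_eq u v -> word_eq v w -> word_eq u w
| word_eq_cancel u v x : word_eq (u ++ [:: x; inv_letter x] ++ v) (u ++ v)
| word_eq_rel u v r : rels r -> word_eq (u ++ r ++ v) (u ++ v).

Definition word_eqb : rel (word A) := fun u v => `[< word_eq u v >].

Lemma word_eqb_refl : reflexive word_eqb.
Proof. by move=> u; apply/asboolP; constructor. Qed.

Lemma word_eqb_sym : symmetric word_eqb.
Proof. by move=> u v; apply/asboolP/asboolP; apply: word_eq_sym. Qed.

Lemma word_eqb_trans : transitive word_eqb.
Proof.
move=> v u w /asboolP uv /asboolP vw.
by apply/asboolP; apply: word_eq_trans vw.
Qed.

Canonical word_equiv := EquivRel word_eqb word_eqb_refl word_eqb_sym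
  word_eqb_trans.

Lemma word_eq_catl p u v : word_eq u v -> word_eq (p ++ u) (p ++ v).
Proof.
elim=> {u v} [u|u v _|u v w _ uv _|u v x|u v r Rr]; rewrite ?(catA p u).
- exact: word_eq_refl.
- exact: word_eq_sym.
- exact: word_eq_trans.
- exact: word_eq_cancel.
- exact: word_eq_rel.
Qed.

Lemma word_eq_catr p u v : word_eq u v -> word_eq (u ++ p) (v ++ p).
Proof.
elim=> {u v} [u|u v _|u v w _ uv _|u v x|u v r Rr]; rewrite -?catA.
- exact: word_eq_refl.
- exact: word_eq_sym.
- exact: word_eq_trans.
- exact: word_eq_cancel.
- exact: word_eq_rel.
Qed.

Lemma inv_letterK : involutive (@inv_letter A).
Proof. by case=> a b; rewrite /inv_letter /= negbK. Qed.

Lemma inv_word_cat (u v : word A) :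
  inv_word (u ++ v) = inv_word v ++ inv_word u.
Proof. by rewrite /inv_word map_cat rev_cat. Qed.

Lemma inv_wordK : involutive (@inv_word A).
Proof.
by move=> u; rewrite /inv_word map_rev revK mapK //; apply: inv_letterK.
Qed.

Lemma word_eq_mulwV u : word_eq (u ++ inv_word u) [::].
Proof.
elim/last_ind: u => [|u x IHu]; first exact: word_eq_refl.
rewrite -cats1 inv_word_cat -catA /=.
exact: word_eq_trans (word_eq_cancel u (inv_word u) x) IHu.
Qed.

Lemma word_eq_mulVw u : word_eq (inv_word u ++ u) [::].
Proof. by have := word_eq_mulwV (inv_word u); rewrite inv_wordK. Qed.

Lemma word_eq_inv u v : word_eq u v -> word_eq (inv_word u) (inv_word v).
Proof.
move=> uv; set u' := inv_word u; set v' := inv_word v.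
apply: (@word_eq_trans _ (u' ++ (v ++ v'))).
  rewrite -{1}(cats0 u'); apply/word_eq_catl/word_eq_sym/word_eq_mulwV.
rewrite catA -{2}(cat0s v'); apply: word_eq_catr.
apply: (@word_eq_trans _ (u' ++ u)); last exact: word_eq_mulVw.
exact/word_eq_catl/word_eq_sym.
Qed.

(* Words modulo word_eq form the quotient of the free group on A by the normal
   closure of rels, that is the group <A | rels>. *)
Definition presented := {eq_quot word_equiv}%qT.
HB.instance Definition _ := Choice.on presented.
HB.instance Definition _ := Quotient.on presented.

Definition class_of (w : word A) : presented := (\pi_presented w)%qT.

Lemma class_of_eq u v : class_of u = class_of v <-> word_eq u v.
Proof. by split=> [/eqquotP/asboolP|uv]//; apply/eqquotP/asboolP. Qed.

Lemma word_eq_repr w : word_eq (repr (class_of w)) w.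
Proof. by apply/class_of_eq; rewrite /class_of reprK. Qed.

Definition pres_one : presented := class_of [::].
Definition pres_inv (x : presented) : presented := class_of (inv_word (repr x)).
Definition pres_mul (x y : presented) : presented :=
  class_of (repr x ++ repr y).

Lemma class_of_cat u v : pres_mul (class_of u) (class_of v) = class_of (u ++ v).
Proof.
apply/class_of_eq; apply: word_eq_trans (word_eq_catr v (word_eq_repr u)).
exact/word_eq_catl/word_eq_repr.
Qed.

Lemma class_of_inv u : pres_inv (class_of u) = class_of (inv_word u).
Proof. exact/class_of_eq/word_eq_inv/word_eq_repr. Qed.

Lemma presW (P : presented -> Prop) :
  (forall w, P (class_of w)) -> forall x, P x.
Proof. by move=> Pw x; rewrite -[x]reprK; apply: Pw. Qed.

Lemma pres_mulA : associative pres_mul.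
Proof.
elim/presW=> u; elim/presW=> v; elim/presW=> w.
by rewrite !class_of_cat catA.
Qed.

Lemma pres_mul1 : left_id pres_one pres_mul.
Proof. by elim/presW=> u; rewrite class_of_cat. Qed.

Lemma pres_mulr1 : right_id pres_one pres_mul.
Proof. by elim/presW=> u; rewrite class_of_cat cats0. Qed.

Lemma pres_mulV : left_inverse pres_one pres_inv pres_mul.
Proof.
elim/presW=> u; rewrite class_of_inv class_of_cat.
exact/class_of_eq/word_eq_mulVw.
Qed.

Lemma pres_mulrV : right_inverse pres_one pres_inv pres_mul.
Proof.
elim/presW=> u; rewrite class_of_inv class_of_cat.
exact/class_of_eq/word_eq_mulwV.
Qed.

HB.instance Definition _ := isGroup.Build presented
  pres_mulA pres_mul1 pres_mulr1 pres_mulV pres_mulrV.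

End Presentation.

Section PropertyT.
Variable R : realType.

(* A completeNormedModType R[i] is a complex Banach space; it is a Hilbert
   space for dot when its norm is the one induced by dot, which is linear in
   its first argument and conjugate-linear in its second one. *)
Definition hilbert_dot (H : completeNormedModType R[i])
    (dot : {dot H for Num.conj}) :=
  forall u : H, `|u| ^+ 2 = dot u u.

(* Surjectivity of each pi g follows from the first two clauses. *)
Definition unitary_rep (G : groupType) (H : completeNormedModType R[i])
    (dot : {dot H for Num.conj}) (pi : G -> {linear H -> H}) :=
  [/\ forall u, pi 1%g u = u,
      forall g h u, pi (g * h)%g u = pi g (pi h u)
    & forall g u v, dot (pi g u) (pi g v) = dot u v].

Definition almost_invariant_vectors (G : groupType) (S : set G)
    (H : completeNormedModType R[i]) (pi : G -> {linear H -> H}) :=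
  forall eps : R, 0 < eps ->
    exists2 u : H, u != 0 & forall s, S s -> `|pi s u - u| < eps%:C%C * `|u|.

Definition invariant_vector (G : groupType)
    (H : completeNormedModType R[i]) (pi : G -> {linear H -> H}) :=
  exists2 u : H, u != 0 & forall g, pi g u = u.

Definition generates (G : groupType) (S : set G) :=
  forall K : set G, K 1%g -> (forall g h, K g -> K h -> K (g * h^-1)%g) ->
    S `<=` K -> K = setT.

Definition property_T (G : groupType) :=
  exists S : set G, [/\ finite_set S, generates S &
    forall (H : completeNormedModType R[i]) (dot : {dot H for Num.conj})
        (pi : G -> {linear H -> H}),
      hilbert_dot dot -> unitary_rep dot pi ->
      almost_invariant_vectors S pi -> invariant_vector pi].

End PropertyT.

Section RandomGroup.
Variables (R : realType) (n k : nat) (d : R).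

(* Cyclically adjacent letters, including the last and the first one, are not
   inverse to each other. *)
Definition cyclically_reduced (w : word 'I_n) :=
  cycle [rel x y | y != inv_letter x] w.

Definition cyc_words : {set k.-tuple (letter 'I_n)} :=
  [set w : k.-tuple (letter 'I_n) | cyclically_reduced w]%SET.

Definition num_relators : nat :=
  Num.truncn ((2 * n%:R - 1 : R) `^ (k%:R * d)).

(* The possible sets of relators, on which the model is the uniform law. *)
Definition relator_sets : {set {set k.-tuple (letter 'I_n)}} :=
  [set rs : {set k.-tuple (letter 'I_n)} |
    (rs \subset cyc_words) && (#|rs| == num_relators)]%SET.

Definition random_group (rs : {set k.-tuple (letter 'I_n)}) : groupType :=
  presented [set w : word 'I_n | exists2 r, r \in rs & w = tval r].

Definition model_prob (P : groupType -> Prop) : R :=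
  #|[set rs in relator_sets | `[< P (random_group rs) >]]%SET|%:R /
  #|relator_sets|%:R.

End RandomGroup.

Definition critical_density (R : realType) (k : nat) : R :=
  match (k %% 3)%N with
  | 0%N => 1 / 3
  | 1%N => (k%:R + 2) / (3 * k%:R)
  | _ => (k%:R + 1) / (3 * k%:R)
  end.

(* Main.v *)
Require Import Defs.
From mathcomp Require Import all_boot all_order all_algebra.
From mathcomp Require Import ring lra zify.

(** Write a for the smallest integer not below k / 3, so that the critical
    density is a / k, and k = a + a + c with 0 < c <= a. The hypothesis says
    that the number N of relators is at least m ^ (a + e) for some e > 0.

    Take three disjoint families of m / 3 generators each, and let X, Y, Z be
    the positive words of length a, a, c over these families, together with
    their inverses. All products x y z are cyclically reduced of
    length k, so a positive proportion of the random relators are of this form,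
    and each of them is a triangle for the generators X, Y, Z. For a
    unitary representation pi and a vector v, an edge (x^-1, y) of the link of
    this triangular presentation satisfies
    |pi(x^-1) v - pi(y) v| = |pi(z) v - v|. The link on X and Y is a random
    bipartite graph with N edges up to a constant, and N exceeds the number of
    its vertices by a power of m; likewise for the other two pairs. So these
    graphs are close to complete bipartite graphs in the strong sense that
    their second singular value is small, and averaging over the edges is
    comparable with averaging over independent x and y. This turns the identity
    above into an inequality between the energies and the Laplacians of X, Y
    and Z ([link_inequality]); the sum of the three inequalities is the
    estimate (L v, v) <= 2 (L v, L v) for the mean Laplacian L, a spectral gap
    that does not depend on pi. It is Zuk's criterion, for three generating
    sets of different word lengths. Iterating v |-> v - L v / 2 from an almost
    invariant vector then yields a nearby vector fixed by X, Y and Z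
    ([spectral_gap_kernel], [near_fixed_vector]).

    The words of length a over one family do not generate a subgroup large
    enough to conclude at once. But a vector fixed by them has a finite orbit
    under that family, a cycle along which all its letters act alike. For every
    generator s there is also a relator s w with w a positive word over
    the family, whence s preserves this cycle, and the sum over the cycle is an
    invariant vector ([cycle_sum_fixed]). It is nonzero since the cycle stays
    near the almost invariant vector.

    The singular values are controlled by the moment method
    ([trace_moment], [kernel_sampling]): the trace of a large, but fixed, power
    of a centered sum of independent random matrices is expanded into words,
    and only words repeating each of their letters contribute. The power is
    chosen in terms of the excess e of the density. Finally, the moment method
    is applied to independent samples, while the model draws a subset of
    prescribed size; as the property of containing a good sample is
    inherited by larger sets, the former are dominated by the latter
    ([sample_coupling]). *)

Set Implicit Arguments.
Unset Strict Implicit.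
Unset Printing Implicit Defensive.

Import Order.TTheory GRing.Theory Num.Theory.
Local Open Scope ring_scope.

Lemma eq_lerW (R : numDomainType) (x y : R) : x = y -> x <= y.
Proof. by move->. Qed.

(** * Positive semidefinite forms and traces *)

Section Psd.
Variables (R : realFieldType) (w : nat).
Implicit Types A B G : 'M[R]_w.

Definition psd_mx G := forall z : 'rV[R]_w, 0 <= (z *m G *m z^T) 0 0.

Lemma conj_mxE (z : 'rV[R]_w) G :
  (z *m G *m z^T) 0 0 = \sum_u \sum_v z 0 u * z 0 v * G u v.
Proof.
rewrite !mxE exchange_big; apply: eq_bigr => v _ /=.
by rewrite !mxE mulr_suml; apply: eq_bigr => u _; rewrite mulrAC.
Qed.

Lemma delta_conj_mxE G u v :
  ((delta_mx 0 u : 'rV[R]_w) *m G *m (delta_mx 0 v : 'rV[R]_w)^T) 0 0 = G u v.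
Proof. by rewrite trmx_delta -rowE -colE !mxE. Qed.

Lemma psd_diag_ge0 G u : psd_mx G -> 0 <= G u u.
Proof. by move=> /(_ (delta_mx 0 u)); rewrite delta_conj_mxE. Qed.

Lemma psd_tr_ge0 G : psd_mx G -> 0 <= \tr G.
Proof. by move=> psdG; apply: sumr_ge0 => u _; apply: psd_diag_ge0. Qed.

Lemma psd_pair G (x y : R) u v : psd_mx G ->
  0 <= x ^+ 2 * G u u + y ^+ 2 * G v v - x * y * (G u v + G v u).
Proof.
move=> /(_ (x *: delta_mx 0 u - y *: delta_mx 0 v)).
set eu : 'rV[R]_w := delta_mx 0 u; set ev : 'rV[R]_w := delta_mx 0 v.
have -> : (x *: eu - y *: ev)^T = x *: eu^T - y *: ev^T.
  by rewrite linearB /= !linearZ.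
rewrite !mulmxBl !mulmxBr -!scalemxAl -!scalemxAr.
have -> (a b c d : 'M[R]_1) :
    (x *: (x *: a) - x *: (y *: b) - (y *: (x *: c) - y *: (y *: d))) 0 0
    = x * (x * a 0 0) - x * (y * b 0 0) - (y * (x * c 0 0) - y * (y * d 0 0)).
  by rewrite !mxE.
rewrite !delta_conj_mxE.
by congr (0 <= _); ring.
Qed.

(** The form is nonnegative at z_v e_u - z_u e_v for all u and v; the sum of
    these inequalities is the claim. *)
Lemma psd_row_le G (z : 'rV[R]_w) : psd_mx G ->
  (z *m G *m z^T) 0 0 <= (\sum_u z 0 u ^+ 2) * \tr G.
Proof.
move=> psdG; rewrite conj_mxE.
have -> : \sum_u \sum_v z 0 u * z 0 v * G u v =
  \sum_u \sum_v z 0 u * z 0 v * (G u v + G v u) / 2.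
  transitivity (\sum_u \sum_v z 0 u * z 0 v * G u v / 2 +
                \sum_u \sum_v z 0 u * z 0 v * G v u / 2).
    rewrite [X in _ = _ + X]exchange_big /= -big_split /=;
      apply: eq_bigr => u _.
    by rewrite -big_split /=; apply: eq_bigr => v _; field.
  rewrite -big_split /=; apply: eq_bigr => u _.
  by rewrite -big_split /=; apply: eq_bigr => v _; field.
have -> : (\sum_u z 0 u ^+ 2) * \tr G =
  \sum_u \sum_v (z 0 v ^+ 2 * G u u + z 0 u ^+ 2 * G v v) / 2.
  transitivity (\sum_u \sum_v z 0 v ^+ 2 * G u u / 2 +
                \sum_u \sum_v z 0 u ^+ 2 * G v v / 2).
    rewrite [X in _ = X + _]exchange_big /= -big_split /= mulr_suml;
      apply: eq_bigr => u _.
    rewrite -big_split /= /mxtrace mulr_sumr; apply: eq_bigr => v _; by field.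
  rewrite -big_split /=; apply: eq_bigr => u _.
  by rewrite -big_split /=; apply: eq_bigr => v _; field.
apply: ler_sum => u _; apply: ler_sum => v _.
by have := psd_pair (z 0 v) (z 0 u) u v psdG; lra.
Qed.

Lemma psd_conj_tr B G : psd_mx G ->
  0 <= \tr (B *m G *m B^T) <= (\sum_u \sum_v B u v ^+ 2) * \tr G.
Proof.
move=> psdG.
have rE u : (B *m G *m B^T) u u = (row u B *m G *m (row u B)^T) 0 0.
  rewrite -row_mul tr_row.
  by rewrite !mxE; apply: eq_bigr => v _; rewrite !mxE.
apply/andP; split; first by apply: sumr_ge0 => u _; rewrite rE.
rewrite mulr_suml; apply: ler_sum => u _; rewrite rE.
apply: le_trans (psd_row_le _ psdG) _; rewrite ler_wpM2r ?psd_tr_ge0 //.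
by apply: ler_sum => v _; rewrite mxE.
Qed.

Lemma tr_sqr_sym A : A^T = A -> \tr (A *m A) = \sum_u \sum_v A u v ^+ 2.
Proof.
move=> symA; apply: eq_bigr => u _; rewrite mxE; apply: eq_bigr => v _.
by rewrite -{2}symA mxE.
Qed.

(** Cauchy-Schwarz for the positive semidefinite form (B, C) |-> tr (B G C^T),
    at B = 1 and C = A. *)
Lemma psd_cauchy A G : A^T = A -> psd_mx G ->
  \tr (A *m G) ^+ 2 <= \tr G * \tr (A *m A *m G).
Proof.
move=> symA psdG.
have quad x : 0 <= x ^+ 2 * \tr G + 2 * x * \tr (A *m G) + \tr (A *m A *m G).
  have /andP[+ _] := psd_conj_tr (x%:M + A) psdG.
  rewrite linearD /= tr_scalar_mx symA mxtrace_mulC (mulmxDl _ _ G) mulmxDl.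
  rewrite !mul_scalar_mx !mulmxDr -scalemxAr mulmxA.
  rewrite ![\tr (_ + _)]linearD /= ![\tr (_ *: _)]linearZ /=.
  rewrite ![\tr (_ + _)]linearD /= ![\tr (_ *: _)]linearZ /=.
  by congr (0 <= _); ring.
(* For tr G = 0 the quadratic polynomial is affine, so its slope vanishes. *)
have [G0|Gpos] := eqVneq (\tr G) 0.
  rewrite G0 mul0r; case: (eqVneq (\tr (A *m G)) 0) => [->|t0];
    first by rewrite expr0n.
  have := quad (- (\tr (A *m A *m G) + 1) / (2 * \tr (A *m G))).
  rewrite G0 mulr0 add0r.
  have -> : 2 * (- (\tr (A *m A *m G) + 1) / (2 * \tr (A *m G))) * \tr (A *m G)
    = - (\tr (A *m A *m G) + 1) by field.
  lra.
have {}Gpos : 0 < \tr G by rewrite lt_def Gpos psd_tr_ge0.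
have := quad (- \tr (A *m G) / \tr G).
have -> : (- \tr (A *m G) / \tr G) ^+ 2 * \tr G + 2 * (- \tr (A *m G) / \tr G)
  * \tr (A *m G)
   = - (\tr (A *m G) ^+ 2 / \tr G) by field; rewrite gt_eqF.
rewrite addrC subr_ge0 ler_pdivrMr // [X in _ <= X -> _]mulrC; exact: id.
Qed.

(** Iterating Cauchy-Schwarz replaces A by its powers; at the end the
    Hilbert-Schmidt norm of a power of A is the trace of the next one. This
    bounds the operator norm of A by a trace without diagonalizing A. *)
Lemma trace_power_bound j A G (l : R) : A^T = A -> psd_mx G -> 0 <= l ->
  \tr (A ^+ (2 ^ j.+1)) <= l ^+ (2 ^ j.+1) -> `|\tr (A *m G)| <= l * \tr G.
Proof.
move=> symA psdG; elim: j A symA l => [|j IH] A symA l l0 trA.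
  have trG := psd_tr_ge0 psdG.
  rewrite -(ler_pXn2r (n := 2)) ?nnegrE ?normr_ge0 ?mulr_ge0 //.
  rewrite -normrX ger0_norm ?sqr_ge0 //.
  apply: le_trans (psd_cauchy symA psdG) _.
  rewrite -[A *m A *m G]mulmxA (mxtrace_mulC A) -{2}symA.
  have /andP[_ AGA] := psd_conj_tr A psdG.
  rewrite exprMn (expr2 (\tr G)) mulrA (mulrC (\tr G)) ler_wpM2r //.
  apply: le_trans AGA _; rewrite ler_wpM2r //.
  by rewrite -tr_sqr_sym // -[A *m A]expr2.
have trG := psd_tr_ge0 psdG.
have symA2 : (A *m A)^T = A *m A by rewrite trmx_mul symA.
have := IH (A *m A) symA2 (l ^+ 2) (sqr_ge0 _).
rewrite -[A *m A]expr2 -!exprM -!expnS => /(_ trA) A2.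
rewrite -(ler_pXn2r (n := 2)) ?nnegrE ?normr_ge0 ?mulr_ge0 //.
rewrite -normrX ger0_norm ?sqr_ge0 //.
apply: le_trans (psd_cauchy symA psdG) _.
rewrite exprMn (expr2 (\tr G)) mulrA (mulrC (\tr G)) ler_wpM2r //.
by apply: le_trans A2; rewrite ler_norm.
Qed.

End Psd.

(** * Moments of sums of independent random matrices *)

Lemma bin_le_exp n m : ('C(n, m) <= n ^ m)%N.
Proof.
have ffact_le k : (n ^_ k <= n ^ k)%N.
  elim: k => // k IH; rewrite ffactnSr expnSr leq_mul ?leq_subr //.
rewrite -(leq_pmul2r (fact_gt0 m)) bin_ffact.
by apply: leq_trans (ffact_le m) _; rewrite leq_pmulr ?fact_gt0.
Qed.

Lemma size_undup_half (T : finType) (s : seq T) :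
  (forall x, x \in s -> 1 < count_mem x s)%N ->
  ((size (undup s)).*2 <= size s)%N.
Proof.
move=> sing.
have szE : size s = (\sum_(x : T) count_mem x s)%N.
  elim: s {sing} => [|y s IH] /=; first by rewrite big1.
  rewrite big_split /= -IH (bigD1 y) //= eqxx big1 ?addn0 // => x /negPf xy.
  by rewrite eq_sym xy.
have -> : size (undup s) = #|[pred x in s]|.
  rewrite -(card_uniqP (undup_uniq s)); apply: eq_card => x.
  by rewrite !inE mem_undup.
rewrite szE -muln2 -sum_nat_const [X in (_ <= X)%N](bigID [pred x in s]) /=.
by apply: leq_trans (leq_addr _ _); apply: leq_sum => x xs; apply: sing.
Qed.

Section Moments.
Variables (R : realFieldType) (Omega : finType) (N w : nat).
Variables (C : Omega -> 'M[R]_w) (rho : R).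
Notation sample := {ffun 'I_N -> Omega}.

Definition redraw (om : sample) i o : sample :=
  [ffun j => if j == i then o else om j].

(** Redrawing one coordinate keeps a sample uniform. This is the form in which
    the independence of the coordinates is used. *)
Lemma sum_redraw (i : 'I_N) (F : sample -> R) :
  #|Omega|%:R * \sum_om F om = \sum_om \sum_o F (redraw om i o).
Proof.
pose h (p : sample * Omega) := (redraw p.1 i p.2, p.1 i).
have hK : involutive h.
  move=> [om o]; rewrite /h /= !ffunE eqxx; congr pair.
  by apply/ffunP => j; rewrite !ffunE; case: eqP => // ->.
transitivity (\sum_(p : sample * Omega) F p.1).
  rewrite -(pair_big xpredT xpredT (fun om (_ : Omega) => F om)) /= mulr_sumr.
  by apply: eq_bigr => om _; rewrite sumr_const mulr_natl.
rewrite pair_big (reindex_inj (inv_inj hK)) /=; apply: eq_bigr => p _.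
by [].
Qed.

Definition entry_sum (M : 'M[R]_w) := \sum_u \sum_v `|M u v|.

Lemma tr_le_entry_sum M : \tr M <= entry_sum M.
Proof.
apply: ler_sum => u _; rewrite (bigD1 u) //=.
by apply: le_trans (ler_norm _) _; rewrite lerDl; apply: sumr_ge0.
Qed.

Lemma entry_sum_mul (A M : 'M[R]_w) :
  entry_sum (A *m M) <= \sum_x (\sum_u `|A u x|) * (\sum_v `|M x v|).
Proof.
have -> : \sum_x (\sum_u `|A u x|) * (\sum_v `|M x v|) =
    \sum_u \sum_v \sum_x `|A u x| * `|M x v|.
  under eq_bigr do rewrite mulr_suml.
  rewrite exchange_big; apply: eq_bigr => u _.
  by rewrite exchange_big; apply: eq_bigr => x _; rewrite mulr_sumr.
apply: ler_sum => u _; apply: ler_sum => v _; rewrite mxE.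
apply: le_trans (ler_norm_sum _ _ _) _.
by apply: ler_sum => x _; rewrite normrM.
Qed.

Definition word_mx (s : seq 'I_N) (om : sample) : 'M[R]_w :=
  \prod_(i <- s) C (om i).

Lemma word_mx_redraw s om i o : i \notin s ->
  word_mx s (redraw om i o) = word_mx s om.
Proof.
move=> i_s; rewrite /word_mx big_seq [RHS]big_seq; apply: eq_bigr => j js.
by rewrite ffunE ifN //; apply: contraNneq i_s => <-.
Qed.

Hypothesis Omega_gt0 : (0 < #|Omega|)%N.
Hypothesis C_centered : \sum_o C o = 0.
Hypothesis C_col : forall o x, \sum_u `|C o u x| <= 2.
Hypothesis C_col_mean :
  forall x, \sum_o \sum_u `|C o u x| <= 2 * rho * #|Omega|%:R.
Hypothesis rho_ge0 : 0 <= rho.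

(** A letter that already occurred costs a factor 2 only, while the draw of a
    new letter is independent of the product accumulated so far and hits the
    current column with probability of order rho. *)
Lemma sum_entry_word s : \sum_om entry_sum (word_mx s om) <=
  #|{: sample}|%:R * w%:R * 2 ^+ size s * rho ^+ size (undup s).
Proof.
elim: s => [|i s IH].
  rewrite /= !mulr1 (eq_bigr (fun _ => w%:R)) ?sumr_const ?mulr_natl // => om _.
  rewrite /word_mx big_nil /entry_sum.
  transitivity (\sum_(u < w) (1 : R)); last by rewrite sumr_const card_ord.
  apply: eq_bigr => u _; rewrite (bigD1 u) //= big1 => [|v /negPf vu].
    by rewrite addr0 mxE eqxx normr1.
  by rewrite mxE eq_sym vu normr0.
have wE om : word_mx (i :: s) om = C (om i) *m word_mx s om.
  by rewrite /word_mx big_cons.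
have row_ge0 om x : 0 <= \sum_v `|word_mx s om x v| by apply: sumr_ge0.
rewrite [size (i :: s)]/= exprS /=.
have [i_s|i_s] := boolP (i \in s).
  apply: le_trans (_ : \sum_om 2 * entry_sum (word_mx s om) <= _); last first.
    by rewrite -mulr_sumr; move: IH; lra.
  apply: ler_sum => om _; rewrite wE; apply: le_trans (entry_sum_mul _ _) _.
  rewrite mulr_sumr; apply: ler_sum => x _; exact: ler_wpM2r.
have T_gt0 : 0 < #|Omega|%:R :> R by rewrite ltr0n.
rewrite -(ler_pM2l T_gt0) (sum_redraw i) /= exprS.
apply: le_trans (_ : \sum_om 2 * rho * #|Omega|%:R * entry_sum (word_mx s om)
  <= _).
  apply: ler_sum => om _.
  apply: le_trans (_ : \sum_o \sum_x (\sum_u `|C o u x|) *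
      (\sum_v `|word_mx s om x v|) <= _).
    apply: ler_sum => o _; rewrite wE word_mx_redraw // ffunE eqxx.
    exact: entry_sum_mul.
  rewrite exchange_big mulr_sumr; apply: ler_sum => x _ /=.
  by rewrite -mulr_suml ler_wpM2r.
rewrite -mulr_sumr.
have c0 : 0 <= 2 * rho * #|Omega|%:R by rewrite !mulr_ge0.
by have := ler_wpM2l c0 IH; lra.
Qed.

(** An index met only once contributes its mean, which vanishes. *)
Lemma sum_tr_singleton s i : count_mem i s = 1%N ->
  \sum_om \tr (word_mx s om) = 0.
Proof.
move=> cnt1; have i_s : i \in s by rewrite -has_pred1 has_count cnt1.
case/splitPr: s / i_s cnt1 => s1 s2.
rewrite count_cat /= eqxx addnCA => /eqP;
  rewrite -[1%N]addn0 eqn_add2l addn_eq0.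
move=> /andP[/eqP/count_memPn i1 /eqP/count_memPn i2].
have T_gt0 : #|Omega|%:R != 0 :> R by rewrite pnatr_eq0 -lt0n.
apply/(mulfI T_gt0); rewrite (sum_redraw i) mulr0; apply: big1 => om _.
transitivity (\sum_o \tr (word_mx s1 om *m C o *m word_mx s2 om)).
  apply: eq_bigr => o _; rewrite /word_mx big_cat big_cons /= ffunE eqxx.
  by rewrite -!/(word_mx _ _) !word_mx_redraw // mulrA.
rewrite -raddf_sum -mulmx_suml -mulmx_sumr C_centered mulmx0 mul0mx.
exact: mxtrace0.
Qed.

Definition letters p (f : {ffun 'I_p -> 'I_N}) : seq 'I_N :=
  [seq f l | l <- enum 'I_p].

Lemma size_letters p (f : {ffun 'I_p -> 'I_N}) : size (letters f) = p.
Proof. by rewrite size_map size_enum_ord. Qed.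

Definition letter_set p (f : {ffun 'I_p -> 'I_N}) : {set 'I_N} :=
  [set f l | l : 'I_p].

Lemma size_undup_letters p (f : {ffun 'I_p -> 'I_N}) :
  size (undup (letters f)) = #|letter_set f|.
Proof.
rewrite -(card_uniqP (undup_uniq _)); apply: eq_card => x.
rewrite mem_undup; apply/mapP/imsetP => [[l _ ->]|[l _ ->]]; exists l => //.
by rewrite mem_enum.
Qed.

Lemma tr_power_expand p (om : sample) :
  \tr ((\sum_i C (om i)) ^+ p) = \sum_(f : {ffun 'I_p -> 'I_N})
     \tr (word_mx (letters f) om).
Proof.
have -> : (\sum_i C (om i)) ^+ p = \prod_(l : 'I_p) \sum_i C (om i).
  by rewrite prodr_const card_ord.
rewrite -raddf_sum; congr (\tr _).
rewrite (bigA_distr_bigA (fun (_ : 'I_p) i => C (om i))) /=.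
by apply: eq_bigr => f _; rewrite /word_mx big_map enumT [index_enum _]unlock.
Qed.

Lemma card_letter_set p m :
  (#|[set f : {ffun 'I_p -> 'I_N} | #|letter_set f| == m]| <= N ^ m * m ^ p)%N.
Proof.
rewrite -sum1dep_card (partition_big (@letter_set p)
  (fun J : {set 'I_N} => J \in [set J : {set 'I_N} | #|J| == m])) =>
    [|f fm] /=; last by rewrite inE.
apply: (@leq_trans (\sum_(J in [set J : {set 'I_N} | #|J| == m]) m ^ p)%N).
  apply: leq_sum => J; rewrite inE => /eqP Jm.
  rewrite sum1dep_card -[X in (_ <= _ ^ X)%N]card_ord -Jm -card_ffun_on.
  apply: subset_leq_card; apply/subsetP => f; rewrite inE => /andP[_ /eqP fJ].
  by apply/ffun_onP => l; rewrite -fJ imset_f.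
by rewrite sum_nat_const card_draws card_ord leq_mul2r bin_le_exp orbT.
Qed.

Lemma sum_letter_set_weights q : 1 <= N%:R * rho ->
  \sum_(f : {ffun 'I_q.*2 -> 'I_N} | (#|letter_set f| <= q)%N)
     rho ^+ #|letter_set f|
  <= q.+1%:R * (q.*2 ^ q.*2)%:R * (N%:R * rho) ^+ q.
Proof.
move=> Nrho.
rewrite (partition_big (fun f => inord #|letter_set f| : 'I_q.+1) xpredT) //=.
apply: le_trans (_ : \sum_(m < q.+1) (q.*2 ^ q.*2)%:R * (N%:R * rho) ^+ q <= _);
  last by rewrite sumr_const card_ord -[_ *+ q.+1]mulr_natl mulrA.
apply: ler_sum => m _.
apply: le_trans (_ : \sum_(f : {ffun 'I_q.*2 -> 'I_N} | #|letter_set f| == m)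
    rho ^+ m <= _).
  rewrite (eq_bigl (fun f => #|letter_set f| == m)) => [|f].
    by apply: eq_lerW; apply: eq_bigr => f /eqP ->.
  apply/andP/eqP => [[fq /eqP <-]|fm]; first by rewrite inordK.
  by rewrite fm -ltnS ltn_ord inord_val.
rewrite sumr_const -[_ *+ #|_|]mulr_natl.
apply: le_trans (_ : (N ^ m * m ^ q.*2)%:R * rho ^+ m <= _).
  rewrite ler_wpM2r ?exprn_ge0 // ler_nat;
    apply: leq_trans (card_letter_set _ _).
  by rewrite cardsE.
rewrite natrM natrX mulrAC -exprMn mulrC ler_pM ?exprn_ge0 ?ler0n //.
- by apply: le_trans Nrho.
- rewrite ler_nat; have [q0|q0] := posnP q.*2; first by rewrite q0.
  by rewrite leq_exp2r //; have := ltn_ord m; lia.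
- by rewrite ler_weXn2l // -ltnS.
Qed.

(** In the expansion of the trace only words in which every index occurs at
    least twice survive. Such a word has at most q distinct letters, hence
    there are about N ^+ q of them, each of weight at most rho ^+ q. *)
Lemma trace_moment q : 1 <= N%:R * rho ->
  \sum_(om : sample) \tr ((\sum_i C (om i)) ^+ q.*2) <=
  #|{: sample}|%:R * w%:R *
    (2 ^+ q.*2 * q.+1%:R * (q.*2 ^ q.*2)%:R * (N%:R * rho) ^+ q).
Proof.
move=> Nrho; under eq_bigr do rewrite tr_power_expand.
rewrite exchange_big (bigID (fun f => #|letter_set f| <= q)%N) /=.
rewrite [X in _ + X]big1 ?addr0 => [|f].
  apply: le_trans (_ :
    \sum_(f : {ffun 'I_q.*2 -> 'I_N} | (#|letter_set f| <= q)%N)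
      #|{: sample}|%:R * w%:R * 2 ^+ q.*2 * rho ^+ #|letter_set f| <= _).
    apply: ler_sum => f _.
    apply: le_trans (_ : \sum_om entry_sum (word_mx (letters f) om) <= _).
      by apply: ler_sum => om _; apply: tr_le_entry_sum.
    by apply: le_trans (sum_entry_word _) _;
      rewrite size_letters size_undup_letters.
  rewrite -mulr_sumr -!mulrA !ler_wpM2l ?exprn_ge0 ?ler0n //.
  by rewrite mulrA; apply: sum_letter_set_weights.
rewrite -ltnNge => qf.
have [/existsP[i /eqP]|] := boolP [exists i, count_mem i (letters f) == 1%N].
  exact: sum_tr_singleton.
rewrite negb_exists => /forallP sing.
suff : ((size (undup (letters f))).*2 <= size (letters f))%N.
  by rewrite size_letters size_undup_letters leq_double leqNgt qf.
apply: size_undup_half => i; rewrite -has_pred1 has_count => i0.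
by rewrite ltn_neqAle eq_sym sing.
Qed.

End Moments.

(** * Uniform estimates for random samples *)

Definition psd_kernel (R : realFieldType) (W : finType) (K : W -> W -> R) :=
  forall z : W -> R, 0 <= \sum_x \sum_y z x * z y * K x y.

Lemma trmx_exp (R : comPzRingType) n (A : 'M[R]_n) p : (A ^+ p)^T = A^T ^+ p.
Proof.
elim: p => [|p IH]; first by rewrite !expr0 trmx1.
by rewrite exprS exprSr -!mulmxE trmx_mul IH.
Qed.

Lemma tr_even_power_ge0 (R : realFieldType) n (A : 'M[R]_n) q :
  A^T = A -> 0 <= \tr (A ^+ q.*2).
Proof.
move=> symA; rewrite -addnn exprD -mulmxE tr_sqr_sym ?trmx_exp ?symA //.
by apply: sumr_ge0 => u _; apply: sumr_ge0 => v _; apply: sqr_ge0.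
Qed.

(** Markov's inequality for the uniform law on S. *)
Lemma markov_count (R : realFieldType) (S : finType) (F : S -> R) (l : R) :
  (forall s, 0 <= F s) -> 0 < l ->
  #|[set s | l < F s]|%:R <= (\sum_s F s) / l.
Proof.
move=> F0 l0; rewrite ler_pdivlMr // -sum1_card natr_sum mulr_suml.
rewrite [X in _ <= X](bigID (fun s => s \in [set s | l < F s])) /=.
apply: le_trans (_ : \sum_(s in [set s | l < F s]) F s <= _); last first.
  by rewrite lerDl; apply: sumr_ge0.
by apply: ler_sum => s; rewrite inE mul1r => /ltW.
Qed.

(** An upper bound for the number of patterns in which words of length 2q can
    repeat their letters, times the factor 2 ^ (2q) lost by centering. *)
Definition moment_const (R : realFieldType) q : R :=
  2 ^+ q.*2 * q.+1%:R * (q.*2 ^ q.*2)%:R.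

Lemma moment_const_ge0 (R : realFieldType) q : 0 <= moment_const R q.
Proof. by rewrite /moment_const !mulr_ge0 ?exprn_ge0 ?ler0n. Qed.

Section KernelSampling.
Variables (R : realFieldType) (Omega W : finType) (N j : nat).
Variables (b : Omega -> W -> W -> R) (rho l : R).
Notation sample := {ffun 'I_N -> Omega}.
Notation q := (2 ^ j)%N.

Definition mean_kernel x y := (\sum_o b o x y) / #|Omega|%:R.

Hypothesis Omega_gt0 : (0 < #|Omega|)%N.
Hypothesis b_sym : forall o x y, b o x y = b o y x.
Hypothesis b_ge0 : forall o x y, 0 <= b o x y.
Hypothesis b_row : forall o x, \sum_y b o x y <= 1.
Hypothesis b_mean : forall x, \sum_y mean_kernel x y <= rho.
Hypothesis rho_N : 1 <= N%:R * rho.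
Hypothesis l_gt0 : 0 < l.

Let T_gt0 : 0 < #|Omega|%:R :> R. Proof. by rewrite ltr0n. Qed.

Let C o : 'M[R]_#|W| := \matrix_(x, y)
  (b o (enum_val x) (enum_val y) - mean_kernel (enum_val x) (enum_val y)).

Let A (om : sample) := \sum_i C (om i).

Lemma sum_enum_val (F : W -> R) : \sum_(x < #|W|) F (enum_val x) = \sum_x F x.
Proof. by rewrite -(big_enum_val _ (A := W)). Qed.

Lemma mean_kernel_ge0 x y : 0 <= mean_kernel x y.
Proof. by rewrite divr_ge0 ?ler0n ?sumr_ge0. Qed.

Lemma mean_kernel_sym x y : mean_kernel x y = mean_kernel y x.
Proof. by congr (_ / _); apply: eq_bigr => o _; apply: b_sym. Qed.

Lemma mean_kernel_row x : \sum_y mean_kernel x y <= 1.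
Proof.
rewrite -mulr_suml exchange_big ler_pdivrMr // mul1r -sumr_const.
exact: ler_sum.
Qed.

Let A_sym om : (A om)^T = A om.
Proof.
apply/matrixP => x y; rewrite mxE !summxE; apply: eq_bigr => i _.
by rewrite !mxE b_sym mean_kernel_sym.
Qed.

Let C_le o x : \sum_y `|C o y x| <=
  \sum_y b o (enum_val x) y + \sum_y mean_kernel (enum_val x) y.
Proof.
rewrite -!sum_enum_val -big_split /=; apply: ler_sum => y _; rewrite mxE.
rewrite b_sym mean_kernel_sym; apply: le_trans (ler_normB _ _) _.
by rewrite !ger0_norm ?mean_kernel_ge0.
Qed.

(** Outside a small set of samples the estimate holds for all K at once, as it
    is a bound on the operator norm of the fluctuation. This uniformity is
    essential: K will be the Gram matrix of an orbit in a representation of the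
    group that the sample defines. *)
Lemma kernel_sampling : exists2 bad : {set sample},
  #|bad|%:R <= #|{: sample}|%:R *
     (#|W|%:R * moment_const R q * (N%:R * rho / l ^+ 2) ^+ q) &
  forall om, om \notin bad -> forall K, psd_kernel K ->
    `|\sum_x \sum_y (\sum_i b (om i) x y - N%:R * mean_kernel x y) * K x y|
    <= l * \sum_x K x x.
Proof.
exists [set om | l ^+ q.*2 < \tr (A om ^+ q.*2)] => [|om].
  apply: le_trans (markov_count _ _) _.
  - by move=> om; apply: tr_even_power_ge0.
  - exact: exprn_gt0.
  rewrite ler_pdivrMr ?exprn_gt0 //.
  have rho_ge0 : 0 <= rho.
    have N0 : 0 <= N%:R :> R by [].
    by move: rho_N N0; nra.
  apply: le_trans (trace_moment Omega_gt0 _ _ _ rho_ge0 q rho_N) _.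
  - apply/matrixP => x y; rewrite summxE mxE.
    under eq_bigr do rewrite mxE.
    rewrite sumrB sumr_const -[_ *+ _]mulr_natl mulrC divfK ?subrr //.
    by rewrite gt_eqF.
  - move=> o x; apply: le_trans (C_le _ _) _.
    by have := b_row o (enum_val x); have := mean_kernel_row (enum_val x); lra.
  - move=> x; apply: le_trans (_ : \sum_o (\sum_y b o (enum_val x) y +
        \sum_y mean_kernel (enum_val x) y) <= _).
      by apply: ler_sum => o _; apply: C_le.
    rewrite big_split sumr_const exchange_big /= -[_ *+ _]mulr_natl.
    have -> : \sum_y \sum_o b o (enum_val x) y =
        #|Omega|%:R * \sum_y mean_kernel (enum_val x) y.
      by rewrite mulr_sumr; apply: eq_bigr => y _; rewrite mulrC divfK ?gt_eqF.
    have := b_mean (enum_val x); set s := \sum_y _ => s_rho.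
    by have := ler_wpM2l (ltW T_gt0) s_rho; lra.
  apply: eq_lerW.
  rewrite expr_div_n -exprM mul2n /moment_const.
  have : l ^+ q.*2 != 0 by rewrite expf_neq0 ?gt_eqF.
  by move=> l0; field.
rewrite inE -leNgt -mul2n -expnS => trA K psdK.
pose G : 'M[R]_#|W| := \matrix_(x, y) K (enum_val x) (enum_val y).
have psdG : psd_mx G.
  move=> z; rewrite conj_mxE; pose z' x := z 0 (enum_rank x).
  apply: le_trans (psdK z') _; apply: eq_lerW.
  rewrite -sum_enum_val; apply: eq_bigr => x _; rewrite -sum_enum_val.
  by apply: eq_bigr => y _; rewrite /z' !enum_valK mxE.
have := trace_power_bound (A_sym om) psdG (ltW l_gt0) trA.
have -> : \tr G = \sum_x K x x.
  by rewrite -sum_enum_val; apply: eq_bigr => x _; rewrite mxE.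
congr (`|_| <= _); rewrite -sum_enum_val /mxtrace.
under eq_bigr do rewrite mxE.
rewrite exchange_big; apply: eq_bigr => x _ /=; rewrite -sum_enum_val.
apply: eq_bigr => y _; rewrite [G _ _]mxE; congr (_ * _).
have -> : A om y x = A om x y by have /matrixP/(_ x y) := A_sym om; rewrite mxE.
rewrite summxE.
transitivity (\sum_i
  (b (om i) (enum_val x) (enum_val y) - mean_kernel (enum_val x) (enum_val y))).
  by apply: eq_bigr => i _; rewrite mxE.
by rewrite sumrB sumr_const card_ord -[_ *+ _]mulr_natl.
Qed.

End KernelSampling.

Definition tally (R : realFieldType) (I Omega U : finType)
    (a : Omega -> option U) (om : I -> Omega) (u : U) : R :=
  \sum_i (a (om i) == Some u)%:R.

Definition fibers_of_size (Omega U : finType) (a : Omega -> option U) g :=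
  forall u, #|[set o | a o == Some u]| = g.

Lemma sum_fiber (R : realFieldType) (Omega U : finType)
    (a : Omega -> option U) g u :
  fibers_of_size a g -> \sum_o (a o == Some u)%:R = g%:R :> R.
Proof.
move/(_ u)=> <-; rewrite -sum1dep_card natr_sum [RHS]big_mkcond /=.
by apply: eq_bigr => o _; case: eqP.
Qed.

Lemma sum_option_le1 (R : realFieldType) (U : finType) (x : option U) :
  \sum_u (x == Some u)%:R <= 1 :> R.
Proof.
case: x => [v|]; last by rewrite big1.
by rewrite (bigD1 v) //= eqxx big1 ?addr0 // => u uv;
  rewrite eqE /= eq_sym (negPf uv).
Qed.

Section Sampling.
Variables (R : rcfType) (Omega : finType) (N j : nat) (delta : R).
Notation sample := {ffun 'I_N -> Omega}.
Notation q := (2 ^ j)%N.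
Notation expected g := (N%:R * g%:R / #|Omega|%:R : R).

Hypothesis Omega_gt0 : (0 < #|Omega|)%N.
Hypothesis delta_gt0 : 0 < delta.

Let T_gt0 : 0 < #|Omega|%:R :> R. Proof. by rewrite ltr0n. Qed.

(** A diagonal kernel turns the operator norm into a maximum over all u. *)
Lemma tally_sampling (U : finType) (a : Omega -> option U) g :
  fibers_of_size a g -> 1 <= expected g ->
  exists2 bad : {set sample},
    #|bad|%:R <= #|{: sample}|%:R *
      (#|U|%:R * moment_const R q * (delta ^+ 2 * expected g)^-1 ^+ q) &
    forall om, om \notin bad ->
      forall u, `|tally R a om u - expected g| <= delta * expected g.
Proof.
move=> fib; set mu := expected g => mu1.
pose b o (x y : U) : R := (x == y)%:R * (a o == Some x)%:R.
have mu0 : 0 < mu by apply: lt_le_trans mu1.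
have sum_b o x (F : U -> R) : \sum_y b o x y * F y = (a o == Some x)%:R * F x.
  rewrite (bigD1 x) //= /b eqxx mul1r big1 ?addr0 // => y /negPf xy.
  by rewrite eq_sym xy !mul0r.
have row_b o x : \sum_y b o x y = (a o == Some x)%:R.
  by rewrite -[RHS]mulr1 -(sum_b o x (fun=> 1)); apply: eq_bigr => y _;
    rewrite mulr1.
have mean_b x y : mean_kernel b x y = (x == y)%:R * (g%:R / #|Omega|%:R).
  by rewrite /mean_kernel -mulr_sumr (sum_fiber _ _ fib) mulrA.
have [|||x|||bad badP good] :=
    @kernel_sampling R Omega U N j b (g%:R / #|Omega|%:R) (delta * mu)
      Omega_gt0.
- by move=> o x y; rewrite /b eq_sym; case: eqP => [->|]; rewrite ?mul0r.
- by move=> o x y; rewrite mulr_ge0.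
- by move=> o x; rewrite row_b; case: (_ == _); rewrite ?ler01.
- rewrite (bigD1 x) //= big1 => [|y /negPf xy].
    by rewrite mean_b eqxx mul1r addr0.
  by rewrite mean_b eq_sym xy mul0r.
- by rewrite mulrA.
- exact: mulr_gt0.
exists bad => [|om om_good u].
  apply: le_trans badP _; apply: eq_lerW.
  congr (_ * (_ * _ ^+ _)); rewrite mulrA -/mu; field.
  by rewrite !gt_eqF.
pose K x y : R := (x == u)%:R * (y == u)%:R.
have sum_K (F : U -> R) : \sum_x F x * (x == u)%:R = F u.
  rewrite (bigD1 u) //= eqxx mulr1 big1 ?addr0 // => x /negPf ->; exact: mulr0.
have psdK : psd_kernel K.
  move=> z; have -> : \sum_x \sum_y z x * z y * K x y = z u ^+ 2.
    rewrite -[in RHS](sum_K z) expr2 mulr_suml; apply: eq_bigr => x _.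
    by rewrite mulr_sumr; apply: eq_bigr => y _; rewrite /K; ring.
  exact: sqr_ge0.
have := good om om_good K psdK.
rewrite [X in _ <= _ * X]sum_K eqxx mulr1.
congr (`|_| <= _); transitivity (\sum_x (\sum_y (\sum_i b (om i) x y -
   N%:R * mean_kernel b x y) * (y == u)%:R) * (x == u)%:R).
  apply: eq_bigr => x _; rewrite mulr_suml; apply: eq_bigr => y _.
  by rewrite /K mulrA mulrAC.
rewrite sum_K sum_K mean_b eqxx mul1r mulrA; congr (_ - _).
by apply: eq_bigr => i _; rewrite /b eqxx mul1r.
Qed.

(** The biadjacency matrix of the sampled bipartite graph is a block of a
    symmetric kernel on the disjoint union of its two sides. *)
Lemma link_sampling (U V : finType) (a : Omega -> option (U * V)) g :
  (0 < #|U|)%N -> (0 < #|V|)%N ->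
  fibers_of_size a g -> 1 <= expected g * (maxn #|U| #|V|)%:R ->
  exists2 bad : {set sample},
    #|bad|%:R <= #|{: sample}|%:R *
      ((#|U| + #|V|)%:R * moment_const R q *
       (delta ^+ 2 * expected g * (minn #|U| #|V|)%:R)^-1 ^+ q) &
    forall om, om \notin bad -> forall K : U + V -> U + V -> R, psd_kernel K ->
     `|\sum_u \sum_v (tally R a om (u, v) - expected g) *
         (K (inl u) (inr v) + K (inr v) (inl u))|
     <= delta * expected g * (#|V|%:R * \sum_u K (inl u) (inl u) +
                              #|U|%:R * \sum_v K (inr v) (inr v)).
Proof.
move=> U0 V0 fib; set mu := expected g; set M := maxn _ _ => muM.
have U0' : 0 < #|U|%:R :> R by rewrite ltr0n.
have V0' : 0 < #|V|%:R :> R by rewrite ltr0n.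
have M0 : 0 < M%:R :> R by rewrite ltr0n leq_max U0.
have mu0 : 0 < mu.
  by rewrite -(pmulr_lgt0 _ M0); apply: lt_le_trans muM.
pose b o (x y : U + V) : R := match x, y with
  | inl u, inr v | inr v, inl u => (a o == Some (u, v))%:R
  | _, _ => 0 end.
have mean_lr u v : mean_kernel b (inl u) (inr v) = g%:R / #|Omega|%:R.
  by rewrite /mean_kernel /b (sum_fiber _ _ fib).
have mean_rl u v : mean_kernel b (inr v) (inl u) = g%:R / #|Omega|%:R.
  by rewrite /mean_kernel /b (sum_fiber _ _ fib).
have mean_ll u u' : mean_kernel b (inl u) (inl u') = 0.
  by rewrite /mean_kernel /b big1 // mul0r.
have mean_rr v v' : mean_kernel b (inr v) (inr v') = 0.
  by rewrite /mean_kernel /b big1 // mul0r.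
have sumUV (F : U + V -> R) : \sum_x F x = \sum_u F (inl u) + \sum_v F (inr v).
  by rewrite big_sumType.
pose s : R := Num.sqrt (#|U|%:R * #|V|%:R).
have s0 : 0 < s by rewrite sqrtr_gt0 mulr_gt0.
have sE : s ^+ 2 = #|U|%:R * #|V|%:R by rewrite sqr_sqrtr // mulr_ge0 // ltW.
have [|||x|||bad badP good] := @kernel_sampling R Omega (U + V)%type N j b
    (g%:R / #|Omega|%:R * M%:R) (delta * mu * s) Omega_gt0.
- by move=> o [u|v] [u'|v'].
- by move=> o [u|v] [u'|v'] //=; rewrite ler0n.
- move=> o [u|v]; rewrite sumUV /=.
    rewrite big1 // add0r.
    apply: le_trans (_ : \sum_v \sum_u (a o == Some (u, v))%:R <= _).
      by apply: ler_sum => v _; rewrite (bigD1 u) //= lerDl sumr_ge0.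
    rewrite exchange_big pair_big /=.
    apply: le_trans (sum_option_le1 R (a o)); apply: eq_lerW.
    by apply: eq_bigr => -[].
  rewrite [X in _ + X]big1 // addr0.
  apply: le_trans (_ : \sum_u \sum_v (a o == Some (u, v))%:R <= _).
    by apply: ler_sum => u _; rewrite (bigD1 v) //= lerDl sumr_ge0.
  rewrite pair_big /=.
  apply: le_trans (sum_option_le1 R (a o)); apply: eq_lerW.
  by apply: eq_bigr => -[].
- case: x => [u|v]; rewrite sumUV.
    rewrite big1 // add0r (eq_bigr (fun=> g%:R / #|Omega|%:R)) //.
    by rewrite sumr_const -[_ *+ _]mulr_natr ler_wpM2l ?divr_ge0 ?ler_nat
      ?leq_maxr.
  rewrite [X in _ + X]big1 // addr0 (eq_bigr (fun=> g%:R / #|Omega|%:R)) //.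
  by rewrite sumr_const -[_ *+ _]mulr_natr ler_wpM2l ?divr_ge0 ?ler_nat
    ?leq_maxl.
- by move: muM; rewrite /mu !mulrA.
- by apply: mulr_gt0 => //; apply: mulr_gt0.
exists bad => [|om om_good K psdK].
  apply: le_trans badP _; rewrite card_sum; apply: eq_lerW.
  congr (_ * (_ * _ ^+ _)).
  have -> : N%:R * (g%:R / #|Omega|%:R * M%:R) = mu * M%:R
    by rewrite /mu !mulrA.
  have min0 : 0 < (minn #|U| #|V|)%:R :> R by rewrite ltr0n leq_min U0.
  have : s ^+ 2 = M%:R * (minn #|U| #|V|)%:R.
    rewrite sE -!natrM; congr (_%:R); rewrite /M /maxn /minn;
      case: ltnP => // _; exact: mulnC.
  rewrite 2!exprMn => ->; field.
  by rewrite !gt_eqF.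
(* The sides may have very different sizes; rescaling K by t spreads the bound
   evenly over both of them, while t (inl u) * t (inr v) = 1 keeps the entries
   that matter. *)
pose t (x : U + V) : R := match x with
  | inl _ => Num.sqrt (#|V|%:R / s)
  | inr _ => Num.sqrt (#|U|%:R / s) end.
have tl u : t (inl u) ^+ 2 = #|V|%:R / s.
  by rewrite sqr_sqrtr // divr_ge0 // ltW.
have tr v : t (inr v) ^+ 2 = #|U|%:R / s.
  by rewrite sqr_sqrtr // divr_ge0 // ltW.
have tt u v : t (inl u) * t (inr v) = 1.
  rewrite -sqrtrM ?divr_ge0 ?(ltW s0) // -[RHS]sqrtr1; congr Num.sqrt.
  have -> : #|V|%:R / s * (#|U|%:R / s) = #|U|%:R * #|V|%:R / s ^+ 2.
    by field; rewrite gt_eqF.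
  by rewrite sE divff // mulf_neq0 // gt_eqF.
pose K' x y := t x * t y * K x y.
have psdK' : psd_kernel K'.
  move=> z; apply: le_trans (psdK (fun x => z x * t x)) _.
  apply: eq_lerW.
  by apply: eq_bigr => x _; apply: eq_bigr => y _; rewrite /K'; ring.
have := good om om_good K' psdK'.
have -> : delta * mu * s * (\sum_x K' x x) =
  delta * mu * (#|V|%:R * \sum_u K (inl u) (inl u) +
                #|U|%:R * \sum_v K (inr v) (inr v)).
  rewrite sumUV /K'; under eq_bigr do rewrite -expr2 tl.
  under [X in _ + X]eq_bigr do rewrite -expr2 tr.
  by rewrite -!mulr_sumr; field; rewrite gt_eqF.
congr (`|_| <= _); rewrite sumUV.
transitivity (\sum_u \sum_v (tally R a om (u, v) - mu) * K (inl u) (inr v) +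
   \sum_u \sum_v (tally R a om (u, v) - mu) * K (inr v) (inl u)).
  congr (_ + _).
    apply: eq_bigr => u _; rewrite sumUV /= big1 ?add0r => [|u' _].
      by apply: eq_bigr => v _; rewrite /K' tt mul1r mean_lr /mu mulrA.
    by rewrite mean_ll big1 // mulr0 subr0 mul0r.
  rewrite [RHS]exchange_big /=; apply: eq_bigr => v _.
  rewrite sumUV /= [X in _ + X]big1 ?addr0 => [|v' _].
    by apply: eq_bigr => u _;
      rewrite /K' (mulrC (t _)) tt mul1r mean_rl /mu mulrA.
  by rewrite mean_rr big1 // mulr0 subr0 mul0r.
rewrite -big_split; apply: eq_bigr => u _ /=; rewrite -big_split /=.
by apply: eq_bigr => v _; rewrite mulrDr.
Qed.

End Sampling.

(** * Samples with repetition and subsets of a given size *)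

Lemma sum_const_pred (R : pzRingType) (T : finType) (P : pred T) (c : R) :
  \sum_(x | P x) c = #|[set x | P x]|%:R * c.
Proof. by rewrite sumr_const cardsE mulr_natl. Qed.

Section Coupling.
Variables (R : realFieldType) (Omega : finType) (N M : nat).
Notation sample := {ffun 'I_N -> Omega}.

Definition drawn (I T : finType) (om : {ffun I -> T}) : {set T} :=
  [set om i | i : I].

Lemma card_drawn (T : finType) (om : {ffun 'I_N -> T}) : (#|drawn om| <= N)%N.
Proof. by apply: leq_trans (leq_imset_card _ _) _; rewrite card_ord. Qed.

Lemma card_supersets (I : {set Omega}) : (#|I| <= M)%N ->
  #|[set S : {set Omega} | (#|S| == M) && (I \subset S)]| =
  'C(#|Omega| - #|I|, M - #|I|).
Proof.
move=> IM; rewrite -cardsT -(cardsDS (subsetT I)) setTD -cards_draws.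
have unionK : {in [set S : {set Omega} | S \subset ~: I & #|S| == M - #|I|]%N &,
    injective (fun S => I :|: S)}.
  move=> S S'; rewrite !inE =>
    /andP[SI _] /andP[SI' _] /(congr1 (fun X => X :\: I)).
  by rewrite !setDUl setDv !set0U !(setDidPl _) // disjoints_subset.
rewrite -(card_in_imset unionK); apply: eq_card => S; rewrite inE.
apply/andP/imsetP => [[/eqP SM IS]|[S' + ->]].
  exists (S :\: I); last by rewrite -{1}(setID S I) (setIidPr IS).
  by rewrite inE cardsDS // SM eqxx setDE subsetIr.
rewrite inE => /andP[S'I /eqP S'M]; rewrite subsetUl; split=> //.
by rewrite cardsU setIC (disjoint_setI0 _) ?disjoints_subset // cards0 subn0
  S'M subnKC.
Qed.

(** The left-hand side depends on the size of S only. *)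
Lemma sum_samples_in (S : {set Omega}) (phi : nat -> R) :
  \sum_(om : sample | drawn om \subset S) phi #|drawn om| =
  \sum_(tau : {ffun 'I_N -> 'I_#|S|}) phi #|drawn tau|.
Proof.
pose h (tau : {ffun 'I_N -> 'I_#|S|}) : sample := [ffun i => enum_val (tau i)].
have h_inj : injective h.
  move=> t1 t2 /ffunP e; apply/ffunP => i; move: (e i); rewrite !ffunE.
  exact: enum_val_inj.
rewrite (eq_bigl [in h @: setT]) => [|om].
  rewrite big_imset => [|? ? _ _ /h_inj //] /=.
  apply: eq_big => [tau|tau _]; rewrite ?inE //; congr phi.
  rewrite -[RHS](card_imset _ (@enum_val_inj _ S)) /drawn -imset_comp.
  by congr #|pred_of_set _|; apply: eq_imset => i; rewrite /= ffunE.
apply/subsetP/imsetP => [omS|[tau _ ->] x /imsetP[i _ ->]]; last first.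
  by rewrite ffunE enum_valP.
have omiS i : om i \in S by apply: omS; apply: imset_f.
exists [ffun i => enum_rank_in (omiS i) (om i)] => //.
by apply/ffunP => i; rewrite !ffunE enum_rankK_in.
Qed.

(** The set of values of a uniform sample, completed to a uniform superset of
    size M, is a uniform M-subset. Counting the pairs (sample, superset) with
    the weight that gives every sample total mass 1 expresses this. *)
Lemma sample_coupling (good : pred sample) (F : pred {set Omega}) :
  (N <= M)%N -> (M <= #|Omega|)%N ->
  (forall om (S : {set Omega}), good om -> drawn om \subset S -> F S) ->
  #|[set om | good om]|%:R * #|[set S : {set Omega} | #|S| == M]|%:R <=
  #|[set S : {set Omega} | (#|S| == M) && F S]|%:R * #|{: sample}|%:R :> R.
Proof.
move=> NM MT goodF.
pose phi m : R := ('C(#|Omega| - m, M - m))%:R^-1.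
pose c : R := \sum_(tau : {ffun 'I_N -> 'I_M}) phi #|drawn tau|.
have phi_ge0 m : 0 <= phi m by rewrite invr_ge0 ler0n.
have c_ge0 : 0 <= c by apply: sumr_ge0.
have mass (om : sample) :
    \sum_(S : {set Omega} | (#|S| == M) && (drawn om \subset S)) phi #|drawn
      om| = 1.
  have drawnM := leq_trans (card_drawn om) NM.
  rewrite sum_const_pred card_supersets // mulfV //.
  by rewrite pnatr_eq0 -lt0n bin_gt0 leq_sub2r.
have inS (S : {set Omega}) : #|S| == M ->
    \sum_(om : sample | drawn om \subset S) phi #|drawn om| = c.
  by move=> /eqP SM; rewrite sum_samples_in SM.
have total : #|{: sample}|%:R = #|[set S : {set Omega} | #|S| == M]|%:R * c.
  transitivity (\sum_(om : sample) \sum_(S : {set Omega} |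
      (#|S| == M) && (drawn om \subset S)) phi #|drawn om|).
    by under eq_bigr do rewrite mass; rewrite sumr_const.
  rewrite (exchange_big_dep (fun S : {set Omega} => #|S| == M)) /= =>
    [|? ? _ /andP[] //].
  transitivity (\sum_(S : {set Omega} | #|S| == M) c).
    apply: eq_bigr => S SM; rewrite -(inS S SM).
    by apply: eq_bigl => om; rewrite SM.
  by rewrite sum_const_pred.
have goodle : #|[set om | good om]|%:R <=
    #|[set S : {set Omega} | (#|S| == M) && F S]|%:R * c.
  rewrite -sum1_card natr_sum.
  apply: le_trans (_ : \sum_(om in [set om | good om]) \sum_(S : {set Omega} |
      (#|S| == M) && (drawn om \subset S)) phi #|drawn om| <= _).
    by apply: ler_sum => om _; rewrite mass.
  rewrite (exchange_big_dep (fun S : {set Omega} => (#|S| == M) && F S)) /=;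
    last first.
    by move=> om S; rewrite inE => gd /andP[-> sub] /=; apply: goodF sub.
  apply: le_trans (_ : \sum_(S : {set Omega} | (#|S| == M) && F S) c <= _).
    apply: ler_sum => S /andP[SM _]; rewrite -(inS S SM) SM /=.
    rewrite [X in _ <= X](bigID good) /=
      (eq_bigl (fun om : sample => (drawn om \subset S) && good om)) => [|om].
      by rewrite lerDl sumr_ge0.
    by rewrite inE andbC.
  by rewrite sum_const_pred.
by rewrite total [X in _ <= X]mulrCA mulrC ler_wpM2l // ler0n.
Qed.

End Coupling.

(** * Fibers of projections *)

Section TripleFibers.
Variables X Y Z : finType.
Implicit Types (x : X) (y : Y) (z : Z).
Notation fiber h u := #|[set t : X * Y * Z | h t == u]|.

Lemma card_fiber1 x : fiber (fun t => t.1.1) x = (#|Y| * #|Z|)%N.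
Proof.
transitivity #|setX (setX [set x] [set: Y]) [set: Z]|.
  by apply: eq_card => -[[x' y'] z']; rewrite !inE /= ?andbT.
by rewrite !cardsX !cards1 !cardsT ?muln1 ?mul1n ?muln1.
Qed.

Lemma card_fiber2 y : fiber (fun t => t.1.2) y = (#|X| * #|Z|)%N.
Proof.
transitivity #|setX (setX [set: X] [set y]) [set: Z]|.
  by apply: eq_card => -[[x' y'] z']; rewrite !inE /= ?andbT.
by rewrite !cardsX !cards1 !cardsT ?muln1 ?mul1n ?muln1.
Qed.

Lemma card_fiber3 z : fiber (fun t => t.2) z = (#|X| * #|Y|)%N.
Proof.
transitivity #|setX (setX [set: X] [set: Y]) [set z]|.
  by apply: eq_card => -[[x' y'] z']; rewrite !inE.
by rewrite !cardsX !cards1 !cardsT ?muln1 ?mul1n ?muln1.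
Qed.

Lemma card_fiber12 u : fiber (fun t => (t.1.1, t.1.2)) u = #|Z|.
Proof.
case: u => x y; transitivity #|setX (setX [set x] [set y]) [set: Z]|.
  by apply: eq_card => -[[x' y'] z']; rewrite !inE xpair_eqE /= ?andbT.
by rewrite !cardsX !cards1 !cardsT ?muln1 ?mul1n ?muln1.
Qed.

Lemma card_fiber23 u : fiber (fun t => (t.1.2, t.2)) u = #|X|.
Proof.
case: u => y z; transitivity #|setX (setX [set: X] [set y]) [set z]|.
  by apply: eq_card => -[[x' y'] z']; rewrite !inE xpair_eqE.
by rewrite !cardsX !cards1 !cardsT ?muln1 ?mul1n ?muln1.
Qed.

Lemma card_fiber31 u : fiber (fun t => (t.2, t.1.1)) u = #|Y|.
Proof.
case: u => z x; transitivity #|setX (setX [set x] [set: Y]) [set z]|.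
  by apply: eq_card => -[[x' y'] z']; rewrite !inE xpair_eqE /= ?andbT andbC.
by rewrite !cardsX !cards1 !cardsT ?muln1 ?mul1n ?muln1.
Qed.

End TripleFibers.

From HB Require Import structures.
From mathcomp Require Import complex.
From mathcomp Require Import all_classical all_reals all_analysis.

Import numFieldNormedType.Exports.
Local Open Scope classical_set_scope.

(** * Hilbert spaces *)

Section HilbertSpace.
Variables (R : realType) (H : completeNormedModType R[i]).
Variable dot : {dot H for Num.conj}.
Hypothesis dotE : hilbert_dot dot.

(** Only the geometry of H as a real inner product space is used below. *)
Definition rdot (u v : H) : R := complex.Re (dot u v).
Definition rnorm (u : H) : R := complex.Re `|u|.
Definition rscale (r : R) (u : H) : H := r%:C%C *: u.

Lemma rdotDl u v w : rdot (u + v) w = rdot u w + rdot v w.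
Proof. by rewrite /rdot linearDl raddfD. Qed.

Lemma rdotC u v : rdot u v = rdot v u.
Proof.
have ReJ (z : R[i]) : complex.Re (Num.conj z) = complex.Re z by case: z.
by rewrite /rdot (hermC dot u v) expr0 mul1r; apply: ReJ.
Qed.

Lemma rdotDr u v w : rdot u (v + w) = rdot u v + rdot u w.
Proof. by rewrite ![rdot u _]rdotC rdotDl. Qed.

Lemma rdotZl r u v : rdot (rscale r u) v = r * rdot u v.
Proof.
rewrite /rdot /rscale linearZl_LR /=; case: (dot u v) => a b /=.
by rewrite mul0r subr0.
Qed.

Lemma rdotZr r u v : rdot u (rscale r v) = r * rdot u v.
Proof. by rewrite rdotC rdotZl rdotC. Qed.

Lemma rdotNl u v : rdot (- u) v = - rdot u v.
Proof. by rewrite /rdot linearNl raddfN. Qed.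

Lemma rdotNr u v : rdot u (- v) = - rdot u v.
Proof. by rewrite ![rdot u _]rdotC rdotNl. Qed.

Lemma rdotBl u v w : rdot (u - v) w = rdot u w - rdot v w.
Proof. by rewrite rdotDl rdotNl. Qed.

Lemma rdotBr u v w : rdot u (v - w) = rdot u v - rdot u w.
Proof. by rewrite rdotDr rdotNr. Qed.

Lemma rdotD_sqr u v : rdot (u + v) (u + v) = rdot u u + 2 * rdot u v + rdot v v.
Proof. by rewrite rdotDl !rdotDr (rdotC v); ring. Qed.

Lemma rdotB_sqr u v : rdot (u - v) (u - v) = rdot u u - 2 * rdot u v + rdot v v.
Proof. by rewrite rdotD_sqr rdotNl !rdotNr; ring. Qed.

Lemma rdot0l v : rdot 0 v = 0. Proof. by rewrite /rdot linear0l. Qed.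

Lemma rdot_suml (I : finType) (F : I -> H) v :
  rdot (\sum_i F i) v = \sum_i rdot (F i) v.
Proof.
by apply: (big_morph (fun u => rdot u v)) => [u w|]; rewrite ?rdotDl ?rdot0l.
Qed.

Lemma rdot_sumr (I : finType) (F : I -> H) v :
  rdot v (\sum_i F i) = \sum_i rdot v (F i).
Proof. by rewrite rdotC rdot_suml; apply: eq_bigr => i _; rewrite rdotC. Qed.

Lemma normcE u : `|u| = (rnorm u)%:C%C.
Proof. by rewrite /rnorm RRe_real // ger0_real. Qed.

Lemma rnorm_ge0 u : 0 <= rnorm u.
Proof. by rewrite -ler0c -normcE. Qed.

Lemma rdotE u : rdot u u = rnorm u ^+ 2.
Proof. by rewrite /rdot -dotE normcE -rmorphXn. Qed.

Lemma rdot_ge0 u : 0 <= rdot u u.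
Proof. by rewrite rdotE sqr_ge0. Qed.

Lemma rnorm_eq0 u : rnorm u = 0 -> u = 0.
Proof. by move=> u0; apply/eqP; rewrite -normr_eq0 normcE u0. Qed.

Lemma rnormD u v : rnorm (u + v) <= rnorm u + rnorm v.
Proof. by rewrite -lecR rmorphD /= -!normcE ler_normD. Qed.

Lemma rnormN u : rnorm (- u) = rnorm u.
Proof. by rewrite /rnorm normrN. Qed.

Lemma rnormB u v : rnorm (u - v) = rnorm (v - u).
Proof. by rewrite -rnormN opprB. Qed.

Lemma rnorm_tri v u w : rnorm (u - w) <= rnorm (u - v) + rnorm (v - w).
Proof. by apply: le_trans (rnormD _ _); rewrite addrA subrK. Qed.

Lemma rnorm_sum (I : finType) (F : I -> H) :
  rnorm (\sum_i F i) <= \sum_i rnorm (F i).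
Proof.
apply: (big_ind2 (fun u r => rnorm u <= r)) => [|u r v s ur vs|//].
  by rewrite /rnorm normr0.
by apply: le_trans (rnormD _ _) _; apply: lerD.
Qed.

Lemma gram_psd (W : finType) (h : W -> H) :
  psd_kernel (fun x y => rdot (h x) (h y)).
Proof.
move=> z; have -> : \sum_x \sum_y z x * z y * rdot (h x) (h y) =
   rdot (\sum_x rscale (z x) (h x)) (\sum_x rscale (z x) (h x)).
  rewrite rdot_suml; apply: eq_bigr => x _; rewrite rdot_sumr.
  by apply: eq_bigr => y _; rewrite rdotZl rdotZr mulrA.
exact: rdot_ge0.
Qed.

(** Steps that decrease geometrically have a limit, by completeness. *)
Lemma geometric_limit (u : nat -> H) (s r : R) : 0 <= s -> 0 <= r < 1 ->
  (forall t, rnorm (u t.+1 - u t) <= s * r ^+ t) ->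
  exists2 v, rnorm (v - u 0) <= s / (1 - r) &
    forall e, 0 < e -> exists t, rnorm (v - u t) < e /\ s * r ^+ t < e.
Proof.
move=> s0 /andP[r0 r1] step.
have r1' : 0 < 1 - r by rewrite subr_gt0.
have tail t m : rnorm (u (t + m)%N - u t) <= s / (1 - r) * r ^+ t.
  suff: rnorm (u (t + m)%N - u t) <= s / (1 - r) * (r ^+ t - r ^+ (t + m)).
    move/le_trans; apply; rewrite ler_wpM2l ?divr_ge0 ?(ltW r1') //.
    by rewrite lerBlDr lerDl exprn_ge0.
  elim: m => [|m IH]; first by rewrite addn0 !subrr mulr0 /rnorm normr0.
  apply: le_trans (rnorm_tri (u (t + m)%N) _ _) _; rewrite addnS.
  have := step (t + m)%N; rewrite exprS.
  have -> : s * r ^+ (t + m) = s / (1 - r) * (r ^+ (t + m) - r * r ^+ (t + m)).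
    by field; rewrite gt_eqF.
  by move: IH; lra.
have small e : 0 < e -> \forall t \near \oo, s / (1 - r) * r ^+ t < e /\ s
  * r ^+ t < e.
  move=> e0.
  have cv c : (fun t => c * r ^+ t) @ \oo --> (0 : R).
    rewrite -[0](mulr0 c); apply: cvgM; first exact: cvg_cst.
    by apply: cvg_expr; rewrite ger0_norm.
  by near=> t; split; near: t; apply: (cvgr_lt 0).
have cvu : cvg (u @ \oo).
  apply: cauchy_cvg; apply/cauchy_exP => e e0.
  have [e' eE] : exists e' : R, e = e'%:C%C.
    by exists (complex.Re e); rewrite RRe_real // gtr0_real.
  rewrite eE ltcR in e0.
  have [t0 _ /(_ t0 (leqnn _)) [t0P _]] := small _ e0.
  exists (u t0); rewrite -ball_normE.
  have : \forall t \near \oo, `|u t0 - u t| < e; last exact.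
  near=> t.
  have t0t : (t0 <= t)%N by near: t; exact: nbhs_infty_ge.
  by rewrite normcE eE ltcR rnormB -(subnKC t0t);
    apply: le_lt_trans (tail _ _) _.
exists (lim (u @ \oo)) => [|e e0].
  apply/ler_addgt0Pl => e e0; have e0' : (0 : R[i]) < e%:C%C by rewrite ltcR.
  have /cvgrPdist_lt/(_ _ e0')[t0 _ /(_ t0 (leqnn _))] := cvu.
  rewrite /= normcE ltcR => lt_e.
  apply: le_trans (rnorm_tri (u t0) _ _) _; rewrite lerD ?(ltW lt_e) //.
  by have := tail 0 t0; rewrite add0n mulr1.
have e0' : (0 : R[i]) < e%:C%C by rewrite ltcR.
have /cvgrPdist_lt/(_ _ e0') near_lim := cvu.
have near_both : \forall t \near \oo, rnorm (lim (u @ \oo) - u t) < e /\ s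
  * r ^+ t < e.
  near=> t; split.
    by rewrite -ltcR -normcE; near: t.
  by have [] : s / (1 - r) * r ^+ t < e /\ s * r ^+ t < e by near: t;
    apply: small.
by have [t0 _ /(_ t0 (leqnn _)) t0P] := near_both; exists t0.
Unshelve. all: by end_near. Qed.

End HilbertSpace.

(** * Fixed vectors from a spectral gap *)

Section SpectralGap.
Variables (R : realType) (H : completeNormedModType R[i]).
Variable dot : {dot H for Num.conj}.
Hypothesis dotE : hilbert_dot dot.
Notation rdot := (rdot dot).
Variable L : H -> H.
Hypothesis L_lin : forall r u v, L (u + rscale r v) = L u + rscale r (L v).
Hypothesis L_sym : forall u v, rdot (L u) v = rdot u (L v).
Hypothesis L_le : forall v, rdot (L v) (L v) <= 2 * rdot (L v) v.
Hypothesis L_gap : forall v, rdot (L v) v <= 2 * rdot (L v) (L v).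

Let rdot_lin r u v : rdot (L (u + rscale r v)) (u + rscale r v) =
  rdot (L u) u + 2 * r * rdot (L u) v + r ^+ 2 * rdot (L v) v.
Proof.
rewrite L_lin !rdotDl !rdotDr !rdotZl !rdotZr (L_sym v) (rdotC dot v).
by ring.
Qed.

Let L_ge0 v : 0 <= rdot (L v) v.
Proof. by have := L_le v; have := rdot_ge0 dotE (L v); lra. Qed.

Let L_ub v : rdot (L v) v <= 2 * rdot v v.
Proof.
have := rdot_ge0 dotE (L v + rscale (-2) v).
rewrite !rdotDl !rdotDr !rdotZl !rdotZr (rdotC dot v).
by have := L_le v; lra.
Qed.

(** The energy (L v, v) drops by a fixed factor along v |-> v - L v / 2, and
    each step is no longer than the square root of the energy, so the orbit
    converges to a vector of zero energy. *)
Lemma spectral_gap_kernel u s : 0 <= s -> 2 * rdot (L u) u <= s ^+ 2 ->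
  exists2 v, rdot (L v) v = 0 & rnorm (v - u) <= 4 * s.
Proof.
move=> s0 Eu; pose P v := v + rscale (- (1 / 2)) (L v).
have P_energy v : rdot (L (P v)) (P v) <= 3 / 4 * rdot (L v) v.
  rewrite rdot_lin; have := L_gap v; have := L_ub (L v).
  by lra.
have P_step v : rdot (P v - v) (P v - v) <= 1 / 2 * rdot (L v) v.
  rewrite /P addrC addKr rdotZl rdotZr; have := L_le v; lra.
pose ut t := iter t P u.
have energy t : 2 * rdot (L (ut t)) (ut t) <= (s * (7 / 8) ^+ t) ^+ 2.
  elim: t => [|t IH]; first by rewrite mulr1.
  have := P_energy (ut t); have := sqr_ge0 (s * (7 / 8) ^+ t).
  have -> : ut t.+1 = P (ut t) by [].
  rewrite [(7 / 8) ^+ t.+1]exprS.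
  have -> : (s * (7 / 8 * (7 / 8) ^+ t)) ^+ 2 = 49 / 64 * (s * (7 / 8) ^+ t) ^+
    2.
    by field.
  by move: IH; lra.
(* (7 / 8) ^ 2 exceeds 3 / 4, the factor by which the energy drops. *)
have step t : rnorm (ut t.+1 - ut t) <= s / 2 * (7 / 8) ^+ t.
  have c0 : 0 <= s / 2 * (7 / 8) ^+ t :> R.
    by rewrite mulr_ge0 ?exprn_ge0 ?divr_ge0 //; lra.
  rewrite -(ler_pXn2r (n := 2)) ?nnegrE ?rnorm_ge0 // -(rdotE dotE).
  apply: le_trans (P_step _) _; have := energy t.
  have -> : (s / 2 * (7 / 8) ^+ t) ^+ 2 = (s * (7 / 8) ^+ t) ^+ 2 / 4 by field.
  by lra.
have r01 : 0 <= (7 / 8 : R) < 1 by lra.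
have s20 : 0 <= s / 2 by lra.
have [v v_u v_lim] := geometric_limit s20 r01 step.
exists v; last by apply: le_trans v_u _; apply: eq_lerW; field.
apply/eqP; rewrite eq_le L_ge0 andbT; apply/ler_addgt0Pr => e e0.
pose e' := Num.min (e / 8) 1.
have e'0 : 0 < e' by rewrite lt_min; lra.
have [t [vt st]] := v_lim _ e'0.
have : rdot (v - ut t) (v - ut t) <= e' ^+ 2.
  by rewrite (rdotE dotE) ler_pXn2r ?nnegrE ?rnorm_ge0 // ltW.
have : (s * (7 / 8) ^+ t) ^+ 2 <= 4 * e' ^+ 2.
  have c0 : 0 <= s / 2 * (7 / 8) ^+ t :> R.
    by rewrite mulr_ge0 ?exprn_ge0 ?divr_ge0 //; lra.
  have -> : s * (7 / 8) ^+ t = 2 * (s / 2 * (7 / 8) ^+ t) by field.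
  rewrite exprMn; have : (s / 2 * (7 / 8) ^+ t) ^+ 2 <= e' ^+ 2.
    by rewrite ler_pXn2r ?nnegrE // ltW.
  lra.
have : e' ^+ 2 <= e / 8.
  have e'1 : e' <= 1 by rewrite ge_min lexx orbT.
  have e'2 : e' <= e / 8 by rewrite ge_min lexx.
  by apply: le_trans e'2; rewrite expr2 ler_piMl // ltW.
have := energy t; have := L_ub (v - ut t).
pose x := ut t; pose y := v - ut t; rewrite -/x -/y.
have vE : v = x + rscale 1 y by rewrite /rscale scale1r addrC subrK.
have : rdot (L v) v <= 2 * rdot (L x) x + 2 * rdot (L y) y.
  have := L_ge0 (x + rscale (-1) y).
  by rewrite vE !rdot_lin; lra.
lra.
Qed.

End SpectralGap.

(** * Unitary representations of groups with many triangular relations *)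

Section TallySums.
Variables (R : realFieldType) (I Omega : finType) (om : I -> Omega).

Lemma sum_option (U : finType) (x : option U) (F : U -> R) :
  \sum_u (x == Some u)%:R * F u = oapp F 0 x.
Proof.
case: x => [v|] /=; last by rewrite big1 // => u _; rewrite mul0r.
rewrite (bigD1 v) //= eqxx mul1r big1 ?addr0 // => u uv.
by rewrite eqE /= eq_sym (negPf uv) mul0r.
Qed.

Lemma tally_sum (U : finType) (a : Omega -> option U) (F : U -> R) :
  \sum_u tally R a om u * F u = \sum_i oapp F 0 (a (om i)).
Proof.
under eq_bigr do rewrite mulr_suml.
by rewrite exchange_big; apply: eq_bigr => i _; rewrite sum_option.
Qed.

Lemma tally_sum_ge (U : finType) (a : Omega -> option U) (F : U -> R) mu delta :
  (forall u, `|tally R a om u - mu| <= delta * mu) -> (forall u, 0 <= F u) ->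
  (1 - delta) * mu * \sum_u F u <= \sum_i oapp F 0 (a (om i)) <=
  (1 + delta) * mu * \sum_u F u.
Proof.
move=> dev F0; rewrite -tally_sum !mulr_sumr; apply/andP; split.
  apply: ler_sum => u _; apply: ler_wpM2r => //.
  by have := dev u; rewrite ler_norml => /andP[]; lra.
apply: ler_sum => u _; apply: ler_wpM2r => //.
by have := dev u; rewrite ler_norml => /andP[]; lra.
Qed.

End TallySums.

(** The multigraph with edges aXY (om i) is close to the complete bipartite
    graph with total weight T: testing against psd kernels bounds the second
    singular value, for vector-valued functions as well as for scalar ones. *)
Definition link_close (R : realFieldType) (I Omega X Y : finType)
  (om : I -> Omega) (aXY : Omega -> option (X * Y)) (T delta : R) :=
  forall K : X + Y -> X + Y -> R, psd_kernel K ->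
  `|\sum_x \sum_y (tally R aXY om (x, y) - T / (#|X|%:R * #|Y|%:R)) *
       (K (inl x) (inr y) + K (inr y) (inl x))|
  <= delta * (T / (#|X|%:R * #|Y|%:R)) *
     (#|Y|%:R * \sum_x K (inl x) (inl x) + #|X|%:R * \sum_y K (inr y) (inr y)).

Definition tally_close (R : realFieldType) (I Omega X : finType)
  (om : I -> Omega) (aX : Omega -> option X) (T delta : R) :=
  forall x, `|tally R aX om x - T / #|X|%:R| <= delta * (T / #|X|%:R).

Section UnitaryAverages.
Variables (R : realType) (H : completeNormedModType R[i]).
Variable dot : {dot H for Num.conj}.
Hypothesis dotE : hilbert_dot dot.
Variables (G : groupType) (pi : G -> {linear H -> H}).
Hypothesis unit_pi : unitary_rep dot pi.
Notation rdot := (rdot dot).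

Definition moved (g : G) (v : H) : H := pi g v - v.

Lemma pi1 v : pi 1%g v = v. Proof. by case: unit_pi. Qed.

Lemma piM g h v : pi (g * h)%g v = pi g (pi h v). Proof. by case: unit_pi. Qed.

Lemma rdot_pi g u v : rdot (pi g u) (pi g v) = rdot u v.
Proof. by case: unit_pi => _ _ dot_pi; congr complex.Re; apply: dot_pi. Qed.

Lemma rdot_piV g u v : rdot (pi g u) v = rdot u (pi g^-1%g v).
Proof. by rewrite -(rdot_pi g^-1%g) -piM mulVg pi1. Qed.

Lemma rnorm_pi g v : rnorm (pi g v) = rnorm v.
Proof.
apply/eqP; rewrite -(eqrXn2 (n := 2)) ?rnorm_ge0 // -!(rdotE dotE).
by rewrite rdot_pi.
Qed.

Lemma moved_sqr g v :
  rdot (moved g v) (moved g v) = 2 * (rdot v v - rdot (pi g v) v).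
Proof. by rewrite rdotB_sqr rdot_pi; ring. Qed.

Section Average.
Variables (X : finType) (gX : X -> G).

(** This is v minus the mean of its translates. *)
Definition laplacian v : H :=
  rscale (- #|X|%:R^-1) (\sum_x moved (gX x) v).

Definition energy v : R :=
  #|X|%:R^-1 * \sum_x rdot (moved (gX x) v) (moved (gX x) v).

Lemma energy_ge0 v : 0 <= energy v.
Proof. by rewrite mulr_ge0 ?invr_ge0 // sumr_ge0 // => x _;
  apply: rdot_ge0. Qed.

Lemma laplacian_lin r u v :
  laplacian (u + rscale r v) = laplacian u + rscale r (laplacian v).
Proof.
rewrite /laplacian /rscale scalerA mulrC -scalerA -scalerDr; congr (_ *: _).
rewrite scaler_sumr -big_split; apply: eq_bigr => x _ /=.
by rewrite /moved linearD linearZ scalerBr opprD addrACA.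
Qed.

(** The squared displacement of v by an isometry g is 2 (v - g v, v). *)
Lemma energy_laplacian v : energy v = 2 * rdot (laplacian v) v.
Proof.
rewrite /energy /laplacian rdotZl rdot_suml mulNr mulrN mulrCA -mulrN;
  congr (_ * _).
rewrite mulr_sumr -sumrN; apply: eq_bigr => x _.
by rewrite moved_sqr rdotBl; ring.
Qed.

Hypothesis X_gt0 : (0 < #|X|)%N.

Let X_neq0 : #|X|%:R != 0 :> R. Proof. by rewrite pnatr_eq0 -lt0n. Qed.

Lemma laplacian_mean (w : H) v : rdot w (laplacian v) =
  - #|X|%:R^-1 * \sum_x rdot w (moved (gX x) v).
Proof. by rewrite rdotZr rdot_sumr. Qed.

(** Jensen's inequality. *)
Lemma laplacian_le_energy v : rdot (laplacian v) (laplacian v) <= energy v.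
Proof.
have : 0 <= \sum_x rdot (moved (gX x) v + laplacian v)
  (moved (gX x) v + laplacian v).
  by apply: sumr_ge0 => x _; apply: rdot_ge0.
under eq_bigr do rewrite rdotD_sqr.
rewrite !big_split /= -mulr_sumr sumr_const -[_ *+ _]mulr_natl.
have -> : \sum_x rdot (moved (gX x) v) (laplacian v) =
    - #|X|%:R * rdot (laplacian v) (laplacian v).
  rewrite [in RHS]laplacian_mean mulrA mulNr mulrN opprK mulfV // mul1r.
  by apply: eq_bigr => x _; rewrite rdotC.
rewrite /energy => jensen; rewrite [X in _ <= X]mulrC ler_pdivlMr ?ltr0n //.
by move: jensen; set s := \sum_x _; lra.
Qed.

Variable inv : X -> X.
Hypothesis invK : involutive inv.
Hypothesis g_inv : forall x, gX (inv x) = (gX x)^-1%g.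

Lemma laplacian_sym u v : rdot (laplacian u) v = rdot u (laplacian v).
Proof.
rewrite laplacian_mean rdotZl; congr (_ * _).
rewrite rdot_suml (reindex_inj (inv_inj invK)); apply: eq_bigr => x _ /=.
by rewrite g_inv /moved rdotBl rdotBr rdot_piV invgK.
Qed.

End Average.

Section Link.
Variables (X Y Z : finType) (gX : X -> G) (gY : Y -> G) (gZ : Z -> G).
Variable (inv : X -> X).
Hypothesis invK : involutive inv.
Hypothesis g_inv : forall x, gX (inv x) = (gX x)^-1%g.
Variables (I Omega : finType) (om : I -> Omega).
Variables (aX : Omega -> option X) (aY : Omega -> option Y)
  (aZ : Omega -> option Z) (aXY : Omega -> option (X * Y)).
Variables (T delta : R).

Hypothesis X_gt0 : (0 < #|X|)%N.
Hypothesis Y_gt0 : (0 < #|Y|)%N.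
Hypothesis Z_gt0 : (0 < #|Z|)%N.
Hypothesis T_gt0 : 0 < T.

Hypothesis triangle : forall i,
  [/\ aX (om i) = None, aY (om i) = None, aZ (om i) = None & aXY (om i) = None]
    \/
  exists x y z, [/\ aX (om i) = Some x, aY (om i) = Some y, aZ (om i) = Some z,
    aXY (om i) = Some (x, y) & (gX x * gY y * gZ z)%g = 1%g].
Hypothesis tallyX : tally_close om aX T delta.
Hypothesis tallyY : tally_close om aY T delta.
Hypothesis tallyZ : tally_close om aZ T delta.
Hypothesis linkXY : link_close om aXY T delta.

(** The squared length of an edge (x^-1, y) of the link, measured on the orbit
    of v, is the displacement of v by the third side of the triangle. *)
Lemma link_inequality v :
  (1 - 2 * delta) * (energy gX v + energy gY v)
    - 2 * rdot (laplacian gX v) (laplacian gY v) <= (1 + delta) * energy gZ v.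
Proof.
have X0 : 0 < #|X|%:R :> R by rewrite ltr0n.
have Y0 : 0 < #|Y|%:R :> R by rewrite ltr0n.
have Z0 : 0 < #|Z|%:R :> R by rewrite ltr0n.
(* Displacements instead of translates of v: then the errors are relative to the
   energies of v instead of its norm. *)
pose f x := moved (gX (inv x)) v; pose h y := moved (gY y) v.
pose sq (w : H) := rdot w w.
have sum_f : \sum_x sq (f x) = #|X|%:R * energy gX v.
  rewrite /energy mulrA mulfV ?gt_eqF // mul1r.
  by rewrite [RHS](reindex_inj (inv_inj invK)).
have sum_h : \sum_y sq (h y) = #|Y|%:R * energy gY v.
  by rewrite /energy mulrA mulfV ?gt_eqF // mul1r.
pose K (a b : X + Y) : R := rdot (match a with inl x => f x | inr y => h y end)
   (match b with inl x => f x | inr y => h y end).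
have psdK : psd_kernel K by apply: gram_psd.
have /andP[geX _] := tally_sum_ge tallyX (fun x => rdot_ge0 dotE (f x)).
have /andP[geY _] := tally_sum_ge tallyY (fun y => rdot_ge0 dotE (h y)).
have /andP[_ leZ] :=
  tally_sum_ge tallyZ (fun z => rdot_ge0 dotE (moved (gZ z) v)).
have key : \sum_i oapp (fun z => sq (moved (gZ z) v)) 0 (aZ (om i)) =
    \sum_i oapp (fun x => sq (f x)) 0 (aX (om i)) +
    \sum_i oapp (fun y => sq (h y)) 0 (aY (om i)) -
    \sum_i oapp (fun p => 2 * rdot (f p.1) (h p.2)) 0 (aXY (om i)).
  rewrite -big_split -sumrB; apply: eq_bigr => i _ /=.
  case: (triangle i) => [[-> -> -> ->]|[x [y [z [-> -> -> -> /= rel]]]]].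
    by rewrite addr0 subr0.
  transitivity (sq (f x - h y)); last first.
    by rewrite /sq rdotB_sqr; ring.
  have -> : f x - h y = pi (gX x)^-1%g v - pi (gY y) v.
    by rewrite /f /h /moved g_inv opprB addrA subrK.
  have -> : gZ z = ((gY y)^-1 * (gX x)^-1)%g.
    by rewrite -(mulg1_eq rel) invgM.
  rewrite /sq -[RHS](rdot_pi (gY y)^-1%g) linearB -!piM mulVg pi1.
  by rewrite /moved.
have cross : \sum_i oapp (fun p => 2 * rdot (f p.1) (h p.2)) 0 (aXY (om i)) =
    \sum_x \sum_y
      tally R aXY om (x, y) * (K (inl x) (inr y) + K (inr y) (inl x)).
  rewrite -tally_sum pair_big /=; apply: eq_bigr => -[x y] _ /=.
  by rewrite /K (rdotC dot (h y)); ring.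
have mean : \sum_x \sum_y (K (inl x) (inr y) + K (inr y) (inl x)) =
    2 * (#|X|%:R * #|Y|%:R) * rdot (laplacian gX v) (laplacian gY v).
  have -> : laplacian gX v = rscale (- #|X|%:R^-1) (\sum_x f x).
    by congr rscale; rewrite (reindex_inj (inv_inj invK)).
  rewrite rdotZl laplacian_mean.
  transitivity (2 * \sum_x \sum_y rdot (f x) (h y)).
    rewrite mulr_sumr; apply: eq_bigr => x _; rewrite mulr_sumr.
    by apply: eq_bigr => y _; rewrite /K (rdotC dot (h y)); ring.
  have -> : \sum_y rdot (\sum_x f x) (moved (gY y) v) =
      \sum_x \sum_y rdot (f x) (h y).
    by rewrite exchange_big /=; apply: eq_bigr => y _; rewrite rdot_suml.
  by field; rewrite !gt_eqF.
have := linkXY psdK; rewrite ler_norml => /andP[_].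
have -> : \sum_x \sum_y (tally R aXY om (x, y) - T / (#|X|%:R * #|Y|%:R)) *
       (K (inl x) (inr y) + K (inr y) (inl x)) =
  \sum_x \sum_y tally R aXY om (x, y) * (K (inl x) (inr y) + K (inr y) (inl x))
  - T / (#|X|%:R * #|Y|%:R) *
    \sum_x \sum_y (K (inl x) (inr y) + K (inr y) (inl x)).
  rewrite mulr_sumr -sumrB; apply: eq_bigr => x _; rewrite mulr_sumr -sumrB.
  by apply: eq_bigr => y _; rewrite mulrBl.
rewrite mean -cross.
move: geX geY leZ; rewrite key sum_f sum_h.
have -> : \sum_z rdot (moved (gZ z) v) (moved (gZ z) v) = #|Z|%:R * energy gZ v.
  by rewrite /energy mulrA mulfV ?gt_eqF // mul1r.
set SX := \sum_i _; set SY := \sum_i _; set SXY := \sum_i _.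
set EX := energy gX v; set EY := energy gY v; set EZ := energy gZ v.
set P := rdot _ _ => geX geY leZ link.
rewrite -(ler_pM2l T_gt0).
have {}geX : (1 - delta) * T * EX <= SX.
  by apply: le_trans geX; apply: eq_lerW; field; rewrite gt_eqF.
have {}geY : (1 - delta) * T * EY <= SY.
  by apply: le_trans geY; apply: eq_lerW; field; rewrite gt_eqF.
have {}leZ : SX + SY - SXY <= (1 + delta) * T * EZ.
  by apply: le_trans leZ _; apply: eq_lerW; field; rewrite gt_eqF.
have {}link : SXY - 2 * T * P <= delta * T * (EX + EY).
  have e1 : T / (#|X|%:R * #|Y|%:R) * (2 * (#|X|%:R * #|Y|%:R) * P) = 2 * T * P.
    by field; rewrite !gt_eqF.
  have e2 : delta * (T / (#|X|%:R * #|Y|%:R)) *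
      (#|Y|%:R * (#|X|%:R * EX) + #|X|%:R * (#|Y|%:R * EY)) =
      delta * T * (EX + EY).
    by field; rewrite !gt_eqF.
  by rewrite -e1 -e2.
by move: geX geY leZ link; lra.
Qed.

End Link.
End UnitaryAverages.

Section Triangles.
Variables (R : realType) (H : completeNormedModType R[i]).
Variable dot : {dot H for Num.conj}.
Hypothesis dotE : hilbert_dot dot.
Variables (G : groupType) (pi : G -> {linear H -> H}).
Hypothesis unit_pi : unitary_rep dot pi.
Notation rdot := (rdot dot).
Notation en := (energy dot pi).
Notation lap := (laplacian pi).

Variables (X Y Z : finType) (gX : X -> G) (gY : Y -> G) (gZ : Z -> G).
Variables (invX : X -> X) (invY : Y -> Y) (invZ : Z -> Z).
Hypothesis invXK : involutive invX.
Hypothesis invYK : involutive invY.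
Hypothesis invZK : involutive invZ.
Hypothesis gX_inv : forall x, gX (invX x) = (gX x)^-1%g.
Hypothesis gY_inv : forall x, gY (invY x) = (gY x)^-1%g.
Hypothesis gZ_inv : forall x, gZ (invZ x) = (gZ x)^-1%g.
Hypothesis X_gt0 : (0 < #|X|)%N.
Hypothesis Y_gt0 : (0 < #|Y|)%N.
Hypothesis Z_gt0 : (0 < #|Z|)%N.
Variables (I Omega : finType) (om : I -> Omega) (T : R).
Variable triangle : Omega -> option (X * Y * Z).
Hypothesis T_gt0 : 0 < T.

Hypothesis triangle_rel : forall i x y z, triangle (om i) = Some (x, y, z) ->
  (gX x * gY y * gZ z = 1)%g.

Let aX o := omap (fun t : X * Y * Z => t.1.1) (triangle o).
Let aY o := omap (fun t : X * Y * Z => t.1.2) (triangle o).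
Let aZ o := omap (fun t : X * Y * Z => t.2) (triangle o).
Let aXY o := omap (fun t : X * Y * Z => (t.1.1, t.1.2)) (triangle o).
Let aYZ o := omap (fun t : X * Y * Z => (t.1.2, t.2)) (triangle o).
Let aZX o := omap (fun t : X * Y * Z => (t.2, t.1.1)) (triangle o).

Hypothesis tallyX : tally_close om aX T (1 / 10).
Hypothesis tallyY : tally_close om aY T (1 / 10).
Hypothesis tallyZ : tally_close om aZ T (1 / 10).
Hypothesis linkXY : link_close om aXY T (1 / 10).
Hypothesis linkYZ : link_close om aYZ T (1 / 10).
Hypothesis linkZX : link_close om aZX T (1 / 10).

Definition mean_laplacian v : H :=
  rscale (1 / 3) (lap gX v + lap gY v + lap gZ v).

Let mean_energy v : rdot (mean_laplacian v) v =
  (en gX v + en gY v + en gZ v) / 6.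
Proof.
by rewrite !(energy_laplacian unit_pi) rdotZl !rdotDl; field.
Qed.

Let mean_sqr v : rdot (mean_laplacian v) (mean_laplacian v) =
  (rdot (lap gX v) (lap gX v) + rdot (lap gY v) (lap gY v)
   + rdot (lap gZ v) (lap gZ v) +
   2 * rdot (lap gX v) (lap gY v) +
   2 * rdot (lap gY v) (lap gZ v) +
   2 * rdot (lap gZ v) (lap gX v)) / 9.
Proof.
rewrite rdotZl rdotZr !rdotDl !rdotDr.
rewrite (rdotC dot (lap gY v) (lap gX v)).
rewrite (rdotC dot (lap gZ v) (lap gY v)).
rewrite (rdotC dot (lap gX v) (lap gZ v)).
by field.
Qed.

Let rdot_le u v : 2 * rdot u v <= rdot u u + rdot v v.
Proof. by have := rdot_ge0 dotE (u - v); rewrite rdotB_sqr; lra. Qed.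

(** The cross terms of the three link inequalities add up to at most a third of
    the square of the sum of the three Laplacians. The factor 2 comes from the
    tolerance 1 / 10; every tolerance below 1 / 5 gives some constant. *)
Let gap v : rdot (mean_laplacian v) v <=
  2 * rdot (mean_laplacian v) (mean_laplacian v).
Proof.
have tri i : triangle (om i) = None \/ exists x y z,
    triangle (om i) = Some (x, y, z) /\ (gX x * gY y * gZ z = 1)%g.
  case e : (triangle (om i)) => [[[x y] z]|]; [right|by left].
  by exists x, y, z; split=> //; apply: triangle_rel e.
have cyc x y z : (gX x * gY y * gZ z = 1)%g -> (gY y * gZ z * gX x = 1)%g.
  rewrite -mulgA => /mulg1_eq <-; exact: mulVg.
have cyc' x y z : (gX x * gY y * gZ z = 1)%g -> (gZ z * gX x * gY y = 1)%g.
  move/mulg1_eq=> <-; by rewrite -mulgA mulVg.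
have link1 : (1 - 2 * (1 / 10)) * (en gX v + en gY v)
    - 2 * rdot (lap gX v) (lap gY v) <= (1 + 1 / 10) * en gZ v.
  apply: (link_inequality dotE unit_pi invXK gX_inv (om := om) (aX := aX)
    (aY := aY) (aZ := aZ) (aXY := aXY) (T := T)) => // i.
  rewrite /aX /aY /aZ /aXY; case: (tri i) => [->|]; first by left.
  by move=> [x [y [z [-> rel]]]]; right; exists x, y, z; split=> //.
have link2 : (1 - 2 * (1 / 10)) * (en gY v + en gZ v)
    - 2 * rdot (lap gY v) (lap gZ v) <= (1 + 1 / 10) * en gX v.
  apply: (link_inequality dotE unit_pi invYK gY_inv (om := om) (aX := aY)
    (aY := aZ) (aZ := aX) (aXY := aYZ) (T := T)) => // i.
  rewrite /aX /aY /aZ /aYZ; case: (tri i) => [->|]; first by left.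
  by move=> [x [y [z [-> rel]]]]; right; exists y, z, x; split=> //; apply: cyc.
have link3 : (1 - 2 * (1 / 10)) * (en gZ v + en gX v)
    - 2 * rdot (lap gZ v) (lap gX v) <= (1 + 1 / 10) * en gY v.
  apply: (link_inequality dotE unit_pi invZK gZ_inv (om := om) (aX := aZ)
    (aY := aX) (aZ := aY) (aXY := aZX) (T := T)) => // i.
  rewrite /aX /aY /aZ /aZX; case: (tri i) => [->|]; first by left.
  by move=> [x [y [z [-> rel]]]]; right; exists z, x, y; split=> //;
    apply: cyc'.
rewrite mean_energy mean_sqr.
have := rdot_le (lap gX v) (lap gY v).
have := rdot_le (lap gY v) (lap gZ v).
have := rdot_le (lap gZ v) (lap gX v).
by move: link1 link2 link3; lra.
Qed.

(** The constant 4 does not depend on the representation, so u may be chosen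
    with s as small as needed against its norm. *)
Lemma near_fixed_vector u s : 0 <= s ->
  (forall x, rnorm (moved pi (gX x) u) <= s) ->
  (forall y, rnorm (moved pi (gY y) u) <= s) ->
  (forall z, rnorm (moved pi (gZ z) u) <= s) ->
  exists v, [/\ forall x, pi (gX x) v = v, forall y, pi (gY y) v = v,
     forall z, pi (gZ z) v = v & rnorm (v - u) <= 4 * s].
Proof.
move=> s0 uX uY uZ.
have energy_le (W : finType) (gW : W -> G) : (0 < #|W|)%N ->
    (forall w, rnorm (moved pi (gW w) u) <= s) -> en gW u <= s ^+ 2.
  move=> W0 uW; rewrite /energy mulrC ler_pdivrMr ?ltr0n // mulr_natr
    -sumr_const.
  by apply: ler_sum => w _; rewrite (rdotE dotE) ler_pXn2r ?nnegrE ?rnorm_ge0.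
have lap_le v : rdot (mean_laplacian v) (mean_laplacian v) <=
    2 * rdot (mean_laplacian v) v.
  rewrite mean_energy mean_sqr.
  have := laplacian_le_energy dotE pi gX X_gt0 v.
  have := laplacian_le_energy dotE pi gY Y_gt0 v.
  have := laplacian_le_energy dotE pi gZ Z_gt0 v.
  have := rdot_le (lap gX v) (lap gY v).
  have := rdot_le (lap gY v) (lap gZ v).
  have := rdot_le (lap gZ v) (lap gX v).
  by lra.
have [|||v Ev vu] := @spectral_gap_kernel _ _ _ dotE mean_laplacian _ _ lap_le
  gap u s s0.
- move=> r a b; rewrite /mean_laplacian !laplacian_lin.
  rewrite [_ + _ + (lap gY a + _)]addrACA [_ + _ + (lap gZ a + _)]addrACA.
  rewrite /rscale -!scalerDr [LHS]scalerDr; congr (_ + _).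
  by rewrite [LHS]scalerA [RHS]scalerA mulrC.
- move=> a b; rewrite rdotZl rdotZr !rdotDl !rdotDr.
  by rewrite (laplacian_sym unit_pi invXK) // (laplacian_sym unit_pi invYK) //
     (laplacian_sym unit_pi invZK).
- rewrite mean_energy; have := energy_le _ _ X_gt0 uX.
  by have := energy_le _ _ Y_gt0 uY; have := energy_le _ _ Z_gt0 uZ; lra.
have en0 (W : finType) (gW : W -> G) : (0 < #|W|)%N -> en gW v <= 0 ->
    forall w, pi (gW w) v = v.
  move=> W0; rewrite /energy mulrC ler_pdivrMr ?ltr0n // mul0r => sum0 w.
  apply/eqP; rewrite -subr_eq0; apply/eqP/rnorm_eq0/eqP.
  rewrite -sqrf_eq0 -(rdotE dotE) eq_le (rdot_ge0 dotE) andbT.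
  apply: le_trans sum0; rewrite (bigD1 w) //= lerDl.
  by apply: sumr_ge0 => x _; apply: rdot_ge0.
move: Ev; rewrite mean_energy.
have := energy_ge0 dotE pi gX v; have := energy_ge0 dotE pi gY v.
have := energy_ge0 dotE pi gZ v => eZ eY eX e0.
by exists v; split=> //; apply: en0 => //; lra.
Qed.

End Triangles.

(** * Words and relators *)

Section PartialInverse.
Variables (P Omega : finType) (f : P -> Omega).
Hypothesis f_inj : injective f.

(** For a parametrization f of the relators of a given form this parses a
    relator; [pinv_fiber] reduces counting relators to counting parameters. *)
Definition pinv (o : Omega) : option P := [pick t | f t == o].

Lemma pinvP o t : pinv o = Some t -> f t = o.
Proof. by rewrite /pinv; case: pickP => // t' /eqP <- [->]. Qed.

Lemma pinvK t : pinv (f t) = Some t.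
Proof.
rewrite /pinv; case: pickP => [t' /eqP/f_inj -> //|/(_ t)].
by rewrite eqxx.
Qed.

Lemma pinv_fiber (U : eqType) (h : P -> U) u :
  #|[set o | omap h (pinv o) == Some u]%SET| = #|[set t | h t == u]%SET|.
Proof.
rewrite -(card_imset [set t | h t == u]%SET f_inj); apply: eq_card => o.
rewrite inE; apply/eqP/imsetP => [|[t + ->]].
  case e : (pinv o) => [t|] //= [htu]; exists t; last by rewrite (pinvP e).
  by rewrite inE htu.
by rewrite inE pinvK => /eqP /= ->.
Qed.

End PartialInverse.

Section Words.
Variable m : nat.
Notation n := (m %/ 3)%N.

Lemma slot_proof (j : 'I_3) (i : 'I_n) : (j * n + i < m)%N.
Proof. by have := ltn_ord j; have := ltn_ord i; have := leq_trunc_div m 3;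
  nia. Qed.

(** The families for different j are disjoint, so that blocks over different
    families never cancel, whatever their signs. *)
Definition slot j i : 'I_m := Ordinal (slot_proof j i).

Lemma slot_inj j j' i i' : slot j i = slot j' i' -> j = j' /\ i = i'.
Proof.
move=> /(congr1 val) /= e.
have ij := ltn_ord i; have ij' := ltn_ord i'.
have jj : j = j' :> nat by nia.
by split; apply: val_inj => //=; move: e; rewrite jj => /addnI.
Qed.

Notation block a := (a.-tuple 'I_n * bool)%type.

Definition positive_word j (s : seq 'I_n) : word 'I_m :=
  [seq (slot j i, true) | i <- s].

Definition block_word j a (x : block a) : word 'I_m :=
  if x.2 then positive_word j x.1 else inv_word (positive_word j x.1).

Definition block_inv a (x : block a) : block a := (x.1, ~~ x.2).

Lemma block_invK a : involutive (@block_inv a).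
Proof. by case=> s b; rewrite /block_inv /= negbK. Qed.

Lemma block_word_inv j a (x : block a) :
  block_word j (block_inv x) = inv_word (block_word j x).
Proof. by case: x => s [] //=; rewrite /block_word /= inv_wordK. Qed.

Lemma size_block_word j a (x : block a) : size (block_word j x) = a.
Proof.
by rewrite /block_word; case: x.2; rewrite ?size_rev ?size_map ?size_tuple.
Qed.

Lemma card_block a : #|{: block a}| = (n ^ a * 2)%N.
Proof. by rewrite card_prod card_tuple card_ord card_bool. Qed.

Lemma block_letters j a (x : block a) l : l \in block_word j x ->
  exists i, l = (slot j i, x.2).
Proof.
rewrite /block_word; case: x.2; first by move=> /mapP[i _ ->]; exists i.
rewrite /inv_word mem_rev => /mapP[l' /mapP[i _ ->] ->].
by exists i.
Qed.

Lemma positive_word_inj j : injective (positive_word j).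
Proof. by apply: inj_map => i i' [/addnI/val_inj]. Qed.

Lemma block_word_inj j a : (0 < a)%N -> injective (@block_word j a).
Proof.
move=> a0 [s b] [s' b'] e.
have [l ls] : exists l, l \in block_word j (s, b).
  have := size_block_word j (s, b).
  case: (block_word _ _) => [/= s0|l w _]; first by rewrite -s0 in a0.
  by exists l; rewrite mem_head.
have [i lE] := block_letters ls.
have bb : b = b'.
  by move: ls; rewrite e => /block_letters[i']; rewrite lE => /(congr1 snd).
rewrite bb in e *; congr pair; apply/val_inj/(@positive_word_inj j).
by move: e; rewrite /block_word /=;
  case: b' {bb} => // /(can_inj (@inv_wordK _)).
Qed.

Lemma no_inverse_cyclically_reduced (w : word 'I_m) :
  (forall l l', l \in w -> l' \in w -> l' != inv_letter l) ->
  cyclically_reduced w.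
Proof.
case: w => [|l0 w] //= nis; rewrite /cyclically_reduced /=.
suff all_path s l : l \in l0 :: w -> {subset s <= l0 :: w} ->
    path [rel x y | y != inv_letter x] l s.
  by apply: all_path => [|l]; rewrite ?mem_head // mem_rcons.
elim: s l => [|l1 s IH] //= l lw sw.
have l1w : l1 \in l0 :: w by apply/sw/mem_head.
apply/andP; split; first exact: nis.
by apply: IH => // l2 l2s; apply: sw; rewrite inE l2s orbT.
Qed.

Lemma positive_cyclically_reduced (w : word 'I_m) :
  all (fun l => l.2) w -> cyclically_reduced w.
Proof.
move=> /allP pos; apply: no_inverse_cyclically_reduced => l l' /pos lp /pos lp'.
by apply: contraTneq lp' => ->; rewrite /= lp.
Qed.

Section Relators.
Variables (k a c : nat).
Hypothesis kE : (a + a + c = k)%N.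
Hypothesis a_gt0 : (0 < a)%N.
Hypothesis c_gt0 : (0 < c)%N.

Notation relator_type := {w : k.-tuple (letter 'I_m) | w \in cyc_words m k}.
Notation triple := (block a * block a * block c)%type.

Let j0 : 'I_3 := @Ordinal 3 0 isT.
Let j1 : 'I_3 := @Ordinal 3 1 isT.
Let j2 : 'I_3 := @Ordinal 3 2 isT.

Definition triple_word (t : triple) : word 'I_m :=
  block_word j0 t.1.1 ++ block_word j1 t.1.2 ++ block_word j2 t.2.

Lemma size_triple_word t : size (triple_word t) == k.
Proof. by rewrite !size_cat !size_block_word addnA kE. Qed.

(** No two letters are inverse to each other at all: within a block the signs
    agree, and different blocks use different generators. *)
Lemma triple_word_reduced t : cyclically_reduced (triple_word t).
Proof.
apply: no_inverse_cyclically_reduced => l l'.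
have kinds x : x \in triple_word t -> exists j i,
    x = (slot j i, if j == j0 then t.1.1.2 else if j == j1 then t.1.2.2 else
      t.2.2).
  rewrite !mem_cat => /or3P[] /block_letters[i ->].
  - by exists j0, i.
  - by exists j1, i.
  - by exists j2, i.
move=> /kinds[j [i ->]] /kinds[j' [i' ->]]; apply/eqP => e.
move: (congr1 fst e) (congr1 snd e) => /= /slot_inj[-> _].
by case: (if _ then _ else _).
Qed.

Lemma triple_relator_proof t : Tuple (size_triple_word t) \in cyc_words m k.
Proof. by rewrite inE; apply: triple_word_reduced. Qed.

Definition triple_relator (t : triple) : relator_type :=
  exist _ (Tuple (size_triple_word t)) (triple_relator_proof t).

Lemma triple_relator_inj : injective triple_relator.
Proof.
move=> [[x y] z] [[x' y'] z'] /(congr1 (fun o : relator_type => tval (val o)))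
  /=.
rewrite /triple_word /= => /eqP; rewrite eqseq_cat ?size_block_word //.
move=> /andP[/eqP/(block_word_inj a_gt0) ->];
  rewrite eqseq_cat ?size_block_word //.
by move=> /andP[/eqP/(block_word_inj a_gt0) -> /eqP/(block_word_inj c_gt0) ->].
Qed.

(** These relators express an arbitrary generator through the first family. *)
Definition letter_word (p : 'I_m * k.-1.-tuple 'I_n) : word 'I_m :=
  (p.1, true) :: positive_word j0 p.2.

Lemma size_letter_word p : size (letter_word p) == k.
Proof. by rewrite /= size_map size_tuple prednK // -kE addn_gt0 addn_gt0 a_gt0.
  Qed.

Lemma letter_relator_proof p : Tuple (size_letter_word p) \in cyc_words m k.
Proof.
rewrite inE; apply: positive_cyclically_reduced => /=.
by apply/allP => l /mapP[i _ ->].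
Qed.

Definition letter_relator p : relator_type :=
  exist _ (Tuple (size_letter_word p)) (letter_relator_proof p).

Lemma letter_relator_inj : injective letter_relator.
Proof.
move=> [s w] [s' w'] /(congr1 (fun o : relator_type => tval (val o))) /=.
by move=> [-> /positive_word_inj/val_inj ->].
Qed.

End Relators.
End Words.

(** * Property (T) from a good sample *)

Section Deterministic.
Variables (R : realType) (m k a c : nat).
Notation n := (m %/ 3)%N.
Hypothesis n_gt0 : (0 < n)%N.
Hypothesis kE : (a + a + c = k)%N.
Hypothesis a_gt0 : (0 < a)%N.
Hypothesis c_gt0 : (0 < c)%N.

Notation relator_type := {w : k.-tuple (letter 'I_m) | w \in cyc_words m k}.
Notation block a := (a.-tuple 'I_n * bool)%type.
Notation triple := (block a * block a * block c)%type.

Definition triangle_of : relator_type -> option triple :=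
  pinv (@triple_relator m k a c kE).

Definition first_letter (o : relator_type) : option 'I_m :=
  omap fst (pinv (letter_relator kE a_gt0) o).

Notation reads h := (fun o => omap h (triangle_of o)).

Definition good_sample N (om : 'I_N -> relator_type) (T : R) := [/\
  [/\ tally_close om (reads (fun t => t.1.1)) T (1 / 10),
      tally_close om (reads (fun t => t.1.2)) T (1 / 10) &
      tally_close om (reads (fun t => t.2)) T (1 / 10)],
  [/\ link_close om (reads (fun t => (t.1.1, t.1.2))) T (1 / 10),
      link_close om (reads (fun t => (t.1.2, t.2))) T (1 / 10) &
      link_close om (reads (fun t => (t.2, t.1.1))) T (1 / 10)] &
  forall s, 0 < tally R first_letter om s].

Section Representation.
Variable rs : {set k.-tuple (letter 'I_m)}.
Notation Gam := (random_group rs).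
Notation rels := [set w : word 'I_m | exists2 r, r \in rs & w = tval r].

Definition elt (w : word 'I_m) : Gam := @class_of _ rels w.

Lemma elt_cat u v : elt (u ++ v) = (elt u * elt v)%g.
Proof. by rewrite /elt -class_of_cat. Qed.

Lemma elt_nil : elt [::] = 1%g. Proof. by []. Qed.

Lemma elt_inv w : elt (inv_word w) = (elt w)^-1%g.
Proof. by rewrite /elt -class_of_inv. Qed.

Lemma elt_relator r : r \in rs -> elt r = 1%g.
Proof.
move=> rrs; apply/class_of_eq; rewrite -(cat0s (tval r)) -{1}(cats0 (tval r)).
by have := @word_eq_rel _ rels [::] [::] r; apply; exists r.
Qed.

Lemma elt_surj (P : Gam -> Prop) : (forall w, P (elt w)) -> forall g, P g.
Proof. exact: presW. Qed.

Definition gens : set Gam := [set elt [:: (s, true)] | s in [set: 'I_m]].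

Lemma gens_closure (K : set Gam) : K 1%g ->
  (forall g h, K g -> K h -> K (g * h^-1)%g) -> gens `<=` K -> K = setT.
Proof.
move=> K1 Kdiv gensK; apply/seteqP; split=> // g _.
have KV h : K h -> K h^-1%g by move=> Kh; rewrite -(mul1g h^-1%g); apply: Kdiv.
elim/elt_surj: g; elim=> [|[s b] w IH]; first by rewrite elt_nil.
rewrite -cat1s elt_cat -(invgK (elt w)); apply: Kdiv; last exact: KV.
have Ks : K (elt [:: (s, true)]) by apply: gensK; exists s.
case: b => //; rewrite (_ : [:: (s, false)] = inv_word [:: (s, true)]) //.
by rewrite elt_inv; apply: KV.
Qed.

Lemma finite_gens : finite_set gens.
Proof. exact/finite_image/finite_finset. Qed.

Variables (H : completeNormedModType R[i]) (dot : {dot H for Num.conj}).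
Variable pi : Gam -> {linear H -> H}.
Hypothesis dotE : hilbert_dot dot.
Hypothesis unit_pi : unitary_rep dot pi.

Let rnorm_piB g u v : rnorm (pi g u - pi g v) = rnorm (u - v).
Proof. by rewrite -linearB (rnorm_pi dotE unit_pi). Qed.

Let rnorm_moved_inv g u : rnorm (moved pi g^-1%g u) = rnorm (moved pi g u).
Proof.
rewrite /moved rnormB -(rnorm_piB g) -(piM unit_pi) mulgV (pi1 unit_pi).
by [].
Qed.

Lemma word_moves_little u e : 0 <= e ->
  (forall s, rnorm (moved pi (elt [:: (s, true)]) u) <= e) ->
  forall w, rnorm (moved pi (elt w) u) <= (size w)%:R * e.
Proof.
move=> e0 gen_e; elim=> [|[s b] w IH].
  by rewrite elt_nil /moved (pi1 unit_pi) subrr /rnorm normr0 mul0r.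
rewrite -cat1s elt_cat /moved (piM unit_pi) /= -addn1 natrD mulrDl mul1r.
apply: le_trans (rnorm_tri (pi (elt [:: (s, b)]) u) _ _) _.
rewrite rnorm_piB lerD //.
case: b; first exact: gen_e.
rewrite (_ : [:: (s, false)] = inv_word [:: (s, true)]) // elt_inv.
by rewrite -/(moved pi _ _) rnorm_moved_inv.
Qed.

Lemma invariant_of_gens v : (forall s, pi (elt [:: (s, true)]) v = v) ->
  forall g, pi g v = v.
Proof.
move=> genv; apply: elt_surj => w; apply/eqP; rewrite -subr_eq0;
  apply/eqP/rnorm_eq0.
apply/eqP; rewrite eq_le rnorm_ge0 andbT.
have := @word_moves_little v 0 (lexx 0); rewrite -/(moved pi _ _).
move=> /(_ _ w); rewrite mulr0; apply => s.
by rewrite /moved genv subrr /rnorm normr0.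
Qed.

(** A vector fixed by all positive words of length a over the first family is
    moved by every letter of that family in the same way, around a cycle of
    length dividing a. A relator that multiplies a generator s by a positive
    word over this family shows that s permutes the cycle too; so the sum of
    the cycle is invariant. *)
Section Cycle.
Notation pos := (positive_word (Ordinal (isT : (0 < 3)%N))).
Variable v : H.
Hypothesis fixed : forall s, size s = a -> pi (elt (pos s)) v = v.
Let i0 : 'I_n := Ordinal n_gt0.

Definition cycle_vec j := pi (elt (pos (nseq j i0))) v.
Notation vj := cycle_vec.

Let pos_cat s1 s2 u :
  pi (elt (pos (s1 ++ s2))) u = pi (elt (pos s1)) (pi (elt (pos s2)) u).
Proof. by rewrite -(piM unit_pi) -elt_cat -map_cat. Qed.

Let pi_inj g u w : pi g u = pi g w -> u = w.
Proof.
move=> e; apply/eqP; rewrite -subr_eq0; apply/eqP/rnorm_eq0.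
by rewrite -(rnorm_piB g) e subrr /rnorm normr0.
Qed.

Let period j : vj (j + a) = vj j.
Proof. by rewrite /cycle_vec nseqD pos_cat fixed ?size_nseq. Qed.

Let letter_shift t j : pi (elt (pos [:: t])) (vj j) = vj j.+1.
Proof.
suff base i : (i < a)%N -> pi (elt (pos [:: t])) (vj i) = vj i.+1.
  have periods b q : vj (b + q * a) = vj b.
    by elim: q => [|q IH]; rewrite ?addn0 // mulSn addnA addnAC period.
  by rewrite (divn_eq j a) addnC -addSn !periods; apply: base; rewrite ltn_mod.
(* Either side becomes v after a - i - 1 further letters. *)
move=> ia; pose p := nseq (a - i.+1) i0.
apply: (@pi_inj (elt (pos p))).
transitivity v.
  rewrite /cycle_vec -!pos_cat fixed // !size_cat !size_nseq /=.
  by lia.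
rewrite /cycle_vec -pos_cat -nseqD fixed // size_nseq; lia.
Qed.

Let word_shift s j : pi (elt (pos s)) (vj j) = vj (j + size s).
Proof.
elim: s j => [|t s IH] j; first by rewrite elt_nil (pi1 unit_pi) addn0.
by rewrite -cat1s pos_cat IH letter_shift /= addnS.
Qed.

Let sum_shift b : \sum_(j < a) vj (j + b) = \sum_(j < a) vj j.
Proof.
elim: b => [|b IH]; first by apply: eq_bigr => j _; rewrite addn0.
rewrite -IH; apply: (addrI (vj b)).
transitivity (\sum_(j < a.+1) vj (j + b)).
  by rewrite big_ord_recl add0n; congr (_ + _); apply: eq_bigr => j _;
    rewrite addnS.
by rewrite big_ord_recr /= addrC addnC period.
Qed.

Definition cycle_sum := \sum_(j < a) vj j.

Lemma cycle_sum_fixed s (p : seq 'I_n) :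
  elt ((s, true) :: pos p) = 1%g ->
  pi (elt [:: (s, true)]) cycle_sum = cycle_sum.
Proof.
move=> rel; rewrite /cycle_sum -[in LHS](sum_shift (size p)) linear_sum.
apply: eq_bigr => j _; rewrite -word_shift -(piM unit_pi) -elt_cat cat1s rel.
exact: pi1 unit_pi _.
Qed.

Lemma cycle_sum_neq0 u s : rnorm (v - u) <= 4 * s ->
  (forall j, (j < a)%N -> rnorm (moved pi (elt (pos (nseq j i0))) u) <= s) ->
  5 * s < rnorm u -> cycle_sum != 0.
Proof.
move=> vu u_s su; apply: contraTneq su => sum0; rewrite -leNgt.
have a0 : 0 < a%:R :> R by rewrite ltr0n.
rewrite -(ler_pM2l a0).
have -> : a%:R * rnorm u = rnorm (\sum_(j < a) (vj j - u)).
  rewrite sumrB -/cycle_sum sum0 sub0r rnormN sumr_const card_ord.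
  by rewrite /rnorm normrMn raddfMn /= mulr_natl.
apply: le_trans (rnorm_sum _) _.
have -> : a%:R * (5 * s) = \sum_(j < a) 5 * s.
  by rewrite sumr_const card_ord; apply: mulr_natl.
apply: ler_sum => j _;
  apply: le_trans (rnorm_tri (pi (elt (pos (nseq j i0))) u) _ _) _.
rewrite rnorm_piB; have := u_s j (ltn_ord j); rewrite /moved; move: vu.
by lra.
Qed.

End Cycle.
End Representation.
Arguments elt : clear implicits.
Arguments gens : clear implicits.

(** Containing a good sample is inherited by larger sets of relators, which is
    what the comparison of the two models of random sets asks for. *)
Theorem good_sample_property_T N (om : 'I_N -> relator_type) T
    (rs : {set k.-tuple (letter 'I_m)}) :
  0 < T -> good_sample om T -> (forall i, val (om i) \in rs) ->
  property_T R (random_group rs).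
Proof.
move=> T0 [[tX tY tZ] [lXY lYZ lZX] letters_hit] om_rs.
exists (gens rs); split; [exact: finite_gens | exact: gens_closure |].
move=> H dot pi dotE unit_pi almost.
have k0 : (0 < k)%N by rewrite -kE addn_gt0 addn_gt0 a_gt0.
have k0R : 0 < k%:R :> R by rewrite ltr0n.
(* Words of length at most k move u by a tenth of its norm at most. *)
pose e : R := (10 * k%:R)^-1.
have e0 : 0 < e by rewrite invr_gt0 mulr_gt0.
have [u u0 ue] := almost e e0.
have nu : 0 < rnorm u.
  by rewrite lt_def rnorm_ge0 andbT; apply: contraNneq u0 => /rnorm_eq0 ->.
have gen_e s : rnorm (moved pi (elt rs [:: (s, true)]) u) <= e * rnorm u.
  have : gens rs (elt rs [:: (s, true)]) by exists s.
  by move=> /ue; rewrite !normcE -rmorphM ltcR => /ltW.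
have eu0 : 0 <= e * rnorm u by rewrite mulr_ge0 ?ltW.
pose s := k%:R * (e * rnorm u).
have s0 : 0 <= s by rewrite mulr_ge0.
have word_s w : (size w <= k)%N -> rnorm (moved pi (elt rs w) u) <= s.
  move=> wk; apply: le_trans (word_moves_little dotE unit_pi eu0 gen_e w) _.
  by rewrite ler_wpM2r // ler_nat.
have relE i x y z : triangle_of (om i) = Some (x, y, z) ->
    (elt rs (block_word (Ordinal (isT : (0 < 3)%N)) x) *
     elt rs (block_word (Ordinal (isT : (1 < 3)%N)) y) *
     elt rs (block_word (Ordinal (isT : (2 < 3)%N)) z) = 1)%g.
  move/pinvP => tri; have wordE : tval (val (om i)) = triple_word (x, y, z).
    by rewrite -tri.
  have := elt_relator (om_rs i); rewrite wordE !elt_cat mulgA; exact: id.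
have card0 b : (0 < #|{: block b}|)%N
  by rewrite card_block muln_gt0 expn_gt0 n_gt0.
have invE j b (x : block b) :
    elt rs (block_word j (block_inv x)) = (elt rs (block_word j x))^-1%g.
  by rewrite block_word_inv elt_inv.
have block_s j b (x : block b) : (b <= k)%N ->
    rnorm (moved pi (elt rs (block_word j x)) u) <= s.
  by move=> bk; apply: word_s; rewrite size_block_word.
have [ak ck] : (a <= k)%N /\ (c <= k)%N.
  by rewrite -kE leq_addl -addnA leq_addr.
(* The vector v is only known to be fixed by the blocks; the cycle through it
   takes care of the single generators. *)
have [x|y|z|v [fX _ _ vu]] := near_fixed_vector dotE unit_pi (@block_invK _ _)
  (@block_invK _ _) (@block_invK _ _) (invE _ _) (invE _ _) (invE _ _)
  (card0 _) (card0 _) (card0 _) T0 relE tX tY tZ lXY lYZ lZX s0 (u := u).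
- exact: block_s.
- exact: block_s.
- exact: block_s.
have fixed w : size w = a ->
    pi (elt rs (positive_word (Ordinal (isT : (0 < 3)%N)) w)) v = v.
  by move/eqP => wa; apply: (fX (Tuple wa, true)).
have s5 : 5 * s < rnorm u.
  have -> : 5 * s = rnorm u / 2 by rewrite /s /e; field; rewrite gt_eqF.
  by lra.
exists (cycle_sum pi v).
  apply: (cycle_sum_neq0 dotE unit_pi vu _ s5) => j ja.
  by apply: word_s; rewrite size_map size_nseq ltnW // (leq_trans ja).
apply: (invariant_of_gens dotE unit_pi) => t.
have : 0 < tally R first_letter om t := letters_hit t.
have [i /eqP fl _|none] := pickP (fun i => first_letter (om i) == Some t);
  last first.
  by rewrite /tally big1 ?ltxx // => i _; rewrite none.
move: fl; rewrite /first_letter.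
case e1 : (pinv _ _) => [[t' p]|] //= -[t't]; rewrite t't in e1.
apply: (cycle_sum_fixed dotE unit_pi fixed (p := p)).
have wordE : tval (val (om i)) = letter_word (t, p) by rewrite -(pinvP e1).
have := elt_relator (om_rs i); rewrite wordE; exact: id.
Qed.

End Deterministic.

(** * Most samples are good *)

Section Probability.
Variables (R : realType) (m k a c N j : nat).
Notation n := (m %/ 3)%N.
Notation q := (2 ^ j)%N.
Hypothesis n_gt1 : (1 < n)%N.
Hypothesis kE : (a + a + c = k)%N.
Hypothesis a_gt0 : (0 < a)%N.
Hypothesis c_gt0 : (0 < c)%N.
Hypothesis c_le_a : (c <= a)%N.

Notation relator_type := {w : k.-tuple (letter 'I_m) | w \in cyc_words m k}.
Notation sample := {ffun 'I_N -> relator_type}.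
Notation block a := (a.-tuple 'I_n * bool)%type.

(** A lower bound, sharp up to a constant factor, for the expected degrees of
    the vertices of the links. *)
Definition degree : R := N%:R / (8 ^ k * n ^ a)%:R.

(** The expected number of relators in the sample that are triangles. *)
Definition triangles : R :=
  N%:R * (#|{: block a}| * #|{: block a}| * #|{: block c}|)%:R /
    #|{: relator_type}|%:R.

Lemma card_relator_type : #|{: relator_type}| = #|cyc_words m k|.
Proof. by rewrite card_sig; apply: eq_card. Qed.

Let m_le4n : (m <= 4 * n)%N.
Proof. by have := ltn_pmod m (isT : 0 < 3)%N; have := divn_eq m 3; lia. Qed.

Let m_gt0 : (0 < m)%N. Proof. by case: (m) n_gt1. Qed.

Lemma card_cyc_words_le : (#|cyc_words m k| <= (8 * n) ^ k)%N.
Proof.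
apply: leq_trans (max_card _) _.
rewrite card_tuple card_prod card_ord card_bool leq_exp2r; last by lia.
by move: m_le4n; lia.
Qed.

Lemma card_cyc_words_ge : (m ^ k <= #|cyc_words m k|)%N.
Proof.
have pos_size (s : k.-tuple 'I_m) : size [seq (i, true) | i <- s] == k.
  by rewrite size_map size_tuple.
pose f s : k.-tuple (letter 'I_m) := Tuple (pos_size s).
have f_inj : injective f.
  move=> s s' /(congr1 val) /= e; apply/val_inj; move: e.
  by apply: inj_map => x y [].
rewrite -[X in (X ^ _)%N]card_ord -card_tuple -(card_codom f_inj).
apply: subset_leq_card; apply/fintype.subsetP => w /codomP[s ->]; rewrite inE.
apply: positive_cyclically_reduced; rewrite /= all_map.
by apply/allP.
Qed.

Let n0 : (0 < n)%N := ltnW n_gt1.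

Let rel_gt0 : (0 < #|{: relator_type}|)%N.
Proof.
rewrite card_relator_type; apply: leq_trans card_cyc_words_ge.
by rewrite expn_gt0; lia.
Qed.

Let degree_le g : (n ^ k <= g * n ^ a)%N ->
  degree <= N%:R * g%:R / #|{: relator_type}|%:R.
Proof.
move=> gk; rewrite /degree -mulrA ler_wpM2l //.
rewrite ler_pdivlMr ?ltr0n // mulrC ler_pdivrMr ?ltr0n ?muln_gt0 ?expn_gt0 ?n0
  //.
rewrite -natrM ler_nat card_relator_type; apply: leq_trans card_cyc_words_le _.
by rewrite expnMn mulnCA leq_mul2l gk orbT.
Qed.

Hypothesis degree_ge1 : 1 <= degree.

Let fail : R := 4 * (n ^ a)%:R * moment_const R q * (100 / degree) ^+ q.

Let d_gt0 : 0 < degree. Proof. exact: lt_le_trans degree_ge1. Qed.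

Let fail_le (U : nat) (mu : R) : (U <= 4 * n ^ a)%N -> degree <= mu ->
  U%:R * moment_const R q * ((1 / 10) ^+ 2 * mu)^-1 ^+ q <= fail.
Proof.
move=> U4 dmu; have mu0 : 0 < mu by apply: lt_le_trans dmu.
have muE : ((1 / 10) ^+ 2 * mu)^-1 = 100 / mu by field; rewrite gt_eqF.
have base_ge0 : 0 <= 100 / mu by rewrite divr_ge0 // ltW.
rewrite /fail -[4 * _]natrM muE; apply: ler_pM.
- by rewrite mulr_ge0 ?moment_const_ge0.
- exact: exprn_ge0.
- by rewrite ler_wpM2r ?moment_const_ge0 // ler_nat.
apply: lerXn2r; rewrite ?nnegrE //; first by rewrite divr_ge0 // ltW.
by rewrite ler_wpM2l // lef_pV2.
Qed.

Let quad_bound A C : (A * A * C <= A * 2 * (C * 2) * A)%N.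
Proof.
have -> : (A * 2 * (C * 2) * A = 4 * (A * A * C))%N by ring.
by rewrite leq_pmull.
Qed.

Let size_bounds A C : (C <= A)%N ->
  [/\ A * 2 <= 4 * A, C * 2 <= 4 * A, A * 2 + A * 2 <= 4 * A,
      A * 2 + C * 2 <= 4 * A & C * 2 + A * 2 <= 4 * A]%N.
Proof. by move=> CA; split; lia. Qed.

Let letters_le : (n ^ k <= n ^ k.-1 * n ^ a)%N.
Proof. by rewrite -expnD leq_exp2l //; lia. Qed.

Let n_pow : (n ^ k = n ^ a * n ^ a * n ^ c)%N.
Proof. by rewrite -kE !expnD. Qed.

Let n_ca : (n ^ c <= n ^ a)%N.
Proof. by rewrite leq_exp2l. Qed.

Let bad_tally (U : finType) (h : relator_type -> option U) g :
  fibers_of_size h g -> (#|U| <= 4 * n ^ a)%N -> (n ^ k <= g * n ^ a)%N ->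
  forall T : R, N%:R * g%:R / #|{: relator_type}|%:R = T / #|U|%:R ->
  exists2 bad : {set sample}, #|bad|%:R <= #|{: sample}|%:R * fail &
    forall om : sample, om \notin bad -> tally_close om h T (1 / 10 : R).
Proof.
move=> fib U4 gk T TE; have dmu := degree_le gk.
have t0 : 0 < 1 / 10 :> R by lra.
have [bad badP good] :=
  tally_sampling j rel_gt0 t0 fib (le_trans degree_ge1 dmu).
exists bad => [|om om_bad u]; last by rewrite -TE; apply: good.
by apply: le_trans badP _; rewrite ler_wpM2l // fail_le.
Qed.

Let bad_link (U V : finType) (h : relator_type -> option (U * V)) g T :
  fibers_of_size h g -> (0 < #|U|)%N -> (0 < #|V|)%N ->
  (#|U| + #|V| <= 4 * n ^ a)%N ->
  (n ^ k <= g * minn #|U| #|V| * n ^ a)%N ->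
  N%:R * g%:R / #|{: relator_type}|%:R = T / (#|U|%:R * #|V|%:R) ->
  exists2 bad : {set sample}, #|bad|%:R <= #|{: sample}|%:R * fail &
    forall om : sample, om \notin bad -> link_close om h T (1 / 10 : R).
Proof.
move=> fib U0 V0 U4 gk TE; have := degree_le gk;
  rewrite natrM mulrA mulrAC => dmu.
have t0 : 0 < 1 / 10 :> R by lra.
have mumax : 1 <= N%:R * g%:R / #|{: relator_type}|%:R * (maxn #|U| #|V|)%:R :>
  R.
  apply: le_trans degree_ge1 _; apply: le_trans dmu _.
  rewrite ler_wpM2l ?mulr_ge0 ?invr_ge0 // ler_nat.
  exact: leq_trans (geq_minl _ _) (leq_maxl _ _).
have [bad badP good] := link_sampling j rel_gt0 t0 U0 V0 fib mumax.
exists bad => [|om om_bad K psdK].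
  by apply: le_trans badP _;
    rewrite ler_wpM2l // -[_ ^+ 2 * _ * _]mulrA fail_le.
by rewrite -TE; apply: good.
Qed.

(** Each of the seven conditions fails with the probability given by the moment
    method for at most 4 n ^ a vertices of expected degree at least [degree].
    The sides of a link may have different sizes; then the degrees on the larger
    side decide, and c <= a makes them large enough. *)
Lemma good_sample_probability : exists2 bad : {set sample},
  #|bad|%:R <= #|{: sample}|%:R *
    (28 * (n ^ a)%:R * moment_const R q * (100 / degree) ^+ q) &
  forall om : sample, om \notin bad -> good_sample kE a_gt0 om triangles.
Proof.
have inj3 := @triple_relator_inj m k a c kE a_gt0 c_gt0.
have inj1 := @letter_relator_inj m k a c kE a_gt0.
have card_a : #|{: block a}| = (n ^ a * 2)%N := card_block m a.
have card_c : #|{: block c}| = (n ^ c * 2)%N := card_block m c.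
have a0 : (0 < n ^ a)%N by rewrite expn_gt0 n0.
have c0 : (0 < n ^ c)%N by rewrite expn_gt0 n0.
have [sa sc saa sac sca] := size_bounds n_ca.
have a0R : #|{: block a}|%:R != 0 :> R.
  by rewrite card_a pnatr_eq0 muln_eq0 negb_or -lt0n a0.
have c0R : #|{: block c}|%:R != 0 :> R.
  by rewrite card_c pnatr_eq0 muln_eq0 negb_or -lt0n c0.
have t0R : #|{: relator_type}|%:R != 0 :> R by rewrite pnatr_eq0 -lt0n.
have pos_a : (0 < #|{: block a}|)%N by rewrite card_a muln_gt0 a0.
have pos_c : (0 < #|{: block c}|)%N by rewrite card_c muln_gt0 c0.
have minE : minn (n ^ a * 2) (n ^ c * 2) = (n ^ c * 2)%N.
  by apply/minn_idPr; rewrite leq_mul2r n_ca.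
have [|||b1 b1P g1] := bad_tally (fun x => etrans (pinv_fiber inj3 _ x)
    (card_fiber1 _ _ x)) _ _ (T := triangles).
- by rewrite card_a.
- by rewrite card_a card_c n_pow quad_bound.
- by rewrite /triangles !natrM; field; rewrite a0R t0R.
have [|||b2 b2P g2] := bad_tally (fun x => etrans (pinv_fiber inj3 _ x)
    (card_fiber2 _ _ x)) _ _ (T := triangles).
- by rewrite card_a.
- by rewrite card_a card_c n_pow quad_bound.
- by rewrite /triangles !natrM; field; rewrite a0R t0R.
have [|||b3 b3P g3] := bad_tally (fun x => etrans (pinv_fiber inj3 _ x)
    (card_fiber3 _ _ x)) _ _ (T := triangles).
- by rewrite card_c.
- rewrite card_a n_pow; apply: leq_trans (quad_bound _ _) _.
  by rewrite !leq_mul2r leq_mul2l leq_mul2r n_ca !orbT.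
- by rewrite /triangles !natrM; field; rewrite c0R t0R.
have [|||b4 b4P g4] := bad_link (fun x => etrans (pinv_fiber inj3 _ x)
    (card_fiber12 _ x)) pos_a pos_a _ _ (T := triangles).
- by rewrite card_a.
- by rewrite card_a card_c minnn n_pow [(n ^ c * 2 * _)%N]mulnC quad_bound.
- by rewrite /triangles !natrM; field; rewrite a0R t0R.
have [|||b5 b5P g5] := bad_link (fun x => etrans (pinv_fiber inj3 _ x)
    (card_fiber23 _ x)) pos_a pos_c _ _ (T := triangles).
- by rewrite card_a card_c.
- by rewrite card_a card_c minE n_pow quad_bound.
- by rewrite /triangles !natrM; field; rewrite a0R c0R t0R.
have [|||b6 b6P g6] := bad_link (fun x => etrans (pinv_fiber inj3 _ x)
    (card_fiber31 _ x)) pos_c pos_a _ _ (T := triangles).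
- by rewrite card_a card_c.
- by rewrite card_a card_c minnC minE n_pow quad_bound.
- by rewrite /triangles !natrM; field; rewrite a0R c0R t0R.
have m_le : (#|{: 'I_m}| <= 4 * n ^ a)%N.
  rewrite card_ord (leq_trans m_le4n) //.
  by rewrite leq_mul2l -{1}(expn1 n) leq_exp2l.
have m0R : #|{: 'I_m}|%:R != 0 :> R by rewrite pnatr_eq0 card_ord -lt0n.
have fiber_letter s :
    #|[set r | first_letter (m := m) kE a_gt0 r == Some s]%SET| = (n ^ k.-1)%N.
  rewrite /first_letter (pinv_fiber inj1).
  transitivity #|finset.setX [set s]%SET [set: k.-1.-tuple 'I_n]%SET|.
    by apply: eq_card => -[s' p]; rewrite !inE /= andbT.
  by rewrite cardsX cards1 cardsT card_tuple card_ord mul1n.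
have [|b7 b7P g7] := bad_tally fiber_letter m_le letters_le
  (T := N%:R * (n ^ k.-1)%:R / #|{: relator_type}|%:R * #|{: 'I_m}|%:R).
- by rewrite mulfK.
have unionP (b b' : {set sample}) (x y : R) : #|b|%:R <= x -> #|b'|%:R <= y ->
    #|b :|: b'|%SET%:R <= x + y.
  move=> bx b'y; apply: le_trans (lerD bx b'y); rewrite -natrD ler_nat.
  by rewrite cardsU leq_subr.
exists (b1 :|: b2 :|: b3 :|: b4 :|: b5 :|: b6 :|: b7)%SET => [|om].
  have := unionP _ _ _ _ (unionP _ _ _ _ (unionP _ _ _ _ (unionP _ _ _ _
    (unionP _ _ _ _ (unionP _ _ _ _ b1P b2P) b3P) b4P) b5P) b6P) b7P.
  move/le_trans; apply; apply: eq_lerW.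
  by rewrite /fail; ring.
rewrite !finset.in_setU !negb_or.
move=> /andP[] /andP[] /andP[] /andP[] /andP[] /andP[] out1 out2 out3 out4 out5
  out6 out7.
split.
- by split; [apply: g1 | apply: g2 | apply: g3].
- by split; [apply: g4 | apply: g5 | apply: g6].
move=> s; have := g7 om out7 s; rewrite mulfK // ler_norml => /andP[low _];
  move: low.
set mu := N%:R * _ / _; have mu0 : 0 < mu.
  exact: lt_le_trans d_gt0 (degree_le letters_le).
by lra.
Qed.

End Probability.

(** * The model *)

Section ModelProb.
Variables (R : realType) (m k a c j : nat) (d : R).
Notation n := (m %/ 3)%N.
Notation q := (2 ^ j)%N.
Notation M := (num_relators m k d).
Hypothesis n_gt1 : (1 < n)%N.
Hypothesis kE : (a + a + c = k)%N.
Hypothesis a_gt0 : (0 < a)%N.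
Hypothesis c_gt0 : (0 < c)%N.
Hypothesis c_le_a : (c <= a)%N.
Hypothesis M_le : (M <= #|cyc_words m k|)%N.
Notation relator_type := {w : k.-tuple (letter 'I_m) | w \in cyc_words m k}.
Notation sample := {ffun 'I_M -> relator_type}.
Notation T_prob := (model_prob m k d (fun G => property_T R G)).

Lemma model_prob_le1 (P : groupType -> Prop) : model_prob m k d P <= 1.
Proof.
rewrite /model_prob; have [->|pos] := posnP #|relator_sets m k d|.
  by rewrite invr0 mulr0.
rewrite ler_pdivrMr ?ltr0n // mul1r ler_nat; apply: subset_leq_card.
by apply/fintype.subsetP => rs; rewrite inE => /andP[].
Qed.

Hypothesis degree_ge1 : 1 <= degree R m k a M.

Lemma model_prob_ge :
  1 - 28 * (n ^ a)%:R * moment_const R q * (100 / degree R m k a M) ^+ q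
    <= T_prob.
Proof.
have [bad badP good] := good_sample_probability j n_gt1 kE a_gt0 c_gt0 c_le_a
  degree_ge1.
set fail := _ * _ ^+ q in badP *.
have t_gt0 : (0 < #|{: relator_type}|)%N.
  rewrite card_relator_type (leq_trans _ (card_cyc_words_ge m k)) //.
  by rewrite expn_gt0 (leq_trans _ (leq_trunc_div m 3)) ?muln_gt0 ?(ltnW n_gt1).
have M_gt0 : 0 < M%:R :> R.
  rewrite lt_def ler0n andbT; apply: contraTneq degree_ge1 => M0.
  by rewrite /degree M0 mul0r ler10.
have T_gt0 : 0 < triangles R m k a c M.
  rewrite divr_gt0 ?ltr0n // mulr_gt0 // ltr0n !card_block.
  by rewrite !muln_gt0 !expn_gt0 (ltnW n_gt1).
pose F (S : {set relator_type}) : bool :=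
  `[< property_T R (random_group (val @: S)%SET) >].
have : #|~: bad|%SET%:R * #|relator_sets m k d|%:R <=
   #|[set rs in relator_sets m k d |
     `[< property_T R (random_group rs) >]]%SET|%:R
   * #|{: sample}|%:R :> R.
  have M_le' : (M <= #|{: relator_type}|)%N by rewrite card_relator_type.
  have goodF (om : sample) (S : {set relator_type}) :
      om \notin bad -> drawn om \subset S -> F S.
    move=> om_good omS; apply/asboolP.
    apply: (good_sample_property_T (ltnW n_gt1) c_gt0 T_gt0 (good om om_good))
      => i.
    by apply/imset_f/(fintype.subsetP omS)/imset_f.
  have val_imset_inj : injective (fun S : {set relator_type} => val @: S)%SET.
    exact/imset_inj/val_inj.
  have -> : #|relator_sets m k d|
    = #|[set S : {set relator_type} | #|S| == M]|%SET.
    by rewrite cards_draws card_draws card_relator_type.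
  have := @sample_coupling R relator_type M M (fun om => om \notin bad) F
    (leqnn M) M_le' goodF.
  rewrite (_ : [set om | om \notin bad]%SET = (~: bad)%SET); last first.
    by apply/setP => om; rewrite !inE.
  move/le_trans; apply;
    rewrite ler_wpM2r // ler_nat -(card_imset _ val_imset_inj).
  apply: subset_leq_card; apply/fintype.subsetP => rs /imsetP[S + ->].
  rewrite !inE => /andP[SM FS]; apply/andP; split; last exact: FS.
  rewrite card_imset ?SM ?andbT; last exact: val_inj.
  by apply/fintype.subsetP => w /imsetP[r _ ->]; apply: (valP r).
have D_gt0 : 0 < #|relator_sets m k d|%:R :> R.
  by rewrite ltr0n cards_draws bin_gt0.
have S_gt0 : 0 < #|{: sample}|%:R :> R
  by rewrite ltr0n card_ffun expn_gt0 t_gt0.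
rewrite /model_prob ler_pdivlMr // => coupled.
rewrite -(ler_pM2r S_gt0); apply: le_trans coupled; rewrite mulrAC ler_pM2r //.
rewrite cardsCs finset.setCK natrB ?max_card // mulrBl mul1r lerD2l lerN2.
by rewrite mulrC.
Qed.

End ModelProb.

(** The critical density is a / k, where a is k / 3 rounded up; 8 <= k leaves
    room for a nonempty third block. *)
Lemma critical_lengths (R : realType) (k : nat) (d : R) :
  (8 <= k)%N -> critical_density R k < d ->
  exists a c, [/\ (a + a + c = k)%N, (0 < c)%N, (c <= a)%N & a%:R < k%:R * d].
Proof.
move=> k8 dk; have k0 : 0 < k%:R :> R by rewrite ltr0n; lia.
pose a := ((k + 2) %/ 3)%N.
have kdiv := divn_eq k 3; have kmod := ltn_pmod k (isT : 0 < 3)%N.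
exists a, (k - (a + a))%N; split; try (by rewrite /a; lia).
suff crit : a%:R = k%:R * critical_density R k by rewrite crit ltr_pM2l.
have a3 : (a * 3 = match k %% 3 with 0 => k | 1 => k + 2 | _ => k + 1 end)%N.
  by rewrite /a; case: (k %% 3)%N kdiv kmod => [|[|[|r]]]; lia.
have {a3} : a%:R * 3 = (match k %% 3 with 0 => k | 1 => k + 2 | _ =>
  k + 1 end)%N%:R :> R.
  by rewrite -a3 natrM.
rewrite /critical_density; case: (k %% 3)%N => [|[|r]]; rewrite ?natrD => a3.
- by rewrite -a3; field.
- have -> : k%:R + 2 = a%:R * 3 :> R by rewrite a3.
  by field; rewrite gt_eqF.
have -> : k%:R + 1 = a%:R * 3 :> R by rewrite a3.
by field; rewrite gt_eqF.
Qed.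

Lemma near_powR_ge (R : realType) (e B : R) : 0 < e -> 0 < B ->
  \forall m \near \oo, B <= (m%:R : R) `^ e.
Proof.
move=> e0 B0; near=> m.
have : B `^ e^-1 <= m%:R by near: m; apply: nbhs_infty_ger.
move=> /(@ge0_ler_powR R e (ltW e0) _ _ (powR_ge0 _ _) (ler0n _ _)).
by rewrite -powRrM mulVf ?gt_eqF // powRr1 // ltW.
Unshelve. all: by end_near. Qed.

Theorem theorem1 (R : realType) (k : nat) (d : R) :
  (8 <= k)%N -> critical_density R k < d -> d < 1 ->
  (fun m : nat => model_prob m k d (fun G => property_T R G)) @ \oo --> (1 : R).
Proof.
move=> k8 dk d1; have [a [c [kE c_gt0 c_le_a akd]]] := critical_lengths k8 dk.
have a_gt0 : (0 < a)%N := leq_trans c_gt0 c_le_a.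
have k0 : (0 < k)%N by apply: leq_trans k8.
have k0R : 0 < k%:R :> R by rewrite ltr0n.
pose kap : R := k%:R * d - a%:R.
have kap0 : 0 < kap by rewrite subr_gt0.
have kd0 : 0 < k%:R * d by apply: le_lt_trans akd.
(* The 2 ^ j-th power of the degree, which is about m ^ kap, beats the number
   m ^ a of vertices of the links. *)
have [j jP] : exists j, a%:R + 1 <= kap * (2 ^ j)%:R.
  exists (Num.truncn ((a%:R + 1) / kap)).+1.
  rewrite mulrC -ler_pdivrMr //; apply: ltW;
    apply: lt_le_trans (truncnS_gt _) _.
  by rewrite ler_nat ltnW // ltn_expl.
pose q := (2 ^ j)%N.
(* B is the loss in degree >= m ^ kap / B, and C / m bounds the probability of
   failure. *)
pose B : R := 2 * (8 ^ k)%:R.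
have B0 : 0 < B by rewrite mulr_gt0 // ltr0n expn_gt0.
pose C : R := 28 * moment_const R q * (100 * B) ^+ q.
have C0 : 0 <= C.
  by rewrite !mulr_ge0 ?moment_const_ge0 ?exprn_ge0 ?mulr_ge0 ?(ltW B0).
apply/cvgrPdist_le => eps eps0; near=> m.
have m6 : (6 <= m)%N by near: m; exact: nbhs_infty_ge.
have m0 : 0 < m%:R :> R by rewrite ltr0n; apply: leq_trans m6.
have m1 : 1 <= m%:R :> R by rewrite ler1n; apply: leq_trans m6.
have n_gt1 : (1 < m %/ 3)%N by rewrite leq_divRL.
pose M := num_relators m k d.
have base_ge : m%:R <= 2 * m%:R - 1 :> R by lra.
have M_ge : m%:R `^ (k%:R * d) / 2 <= M%:R.
  have : (2 * m%:R - 1 : R) `^ (k%:R * d) < M.+1%:R by apply: truncnS_gt.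
  have : m%:R `^ (k%:R * d) <= (2 * m%:R - 1 : R) `^ (k%:R * d).
    by apply: ge0_ler_powR; rewrite ?nnegrE ?(ltW kd0) // ; lra.
  have : 2 <= (m%:R : R) `^ (k%:R * d) by near: m; apply: near_powR_ge.
  by rewrite -[M.+1]addn1 natrD; lra.
have M_le : (M <= #|cyc_words m k|)%N.
  apply: leq_trans (card_cyc_words_ge m k); rewrite -(ler_nat R).
  have base_ge0 : 0 <= 2 * m%:R - 1 :> R by lra.
  have M_trunc : M%:R <= (2 * m%:R - 1 : R) `^ (k%:R * d).
    by rewrite truncn_le powR_ge0.
  apply: le_trans M_trunc _.
  apply: le_trans (_ : (2 * m%:R) `^ (k%:R * d) <= _).
    by apply: ge0_ler_powR; rewrite ?nnegrE ?(ltW kd0) //; lra.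
  rewrite powRM ?ler0n // natrX -powR_mulrn ?ler0n //.
  have -> : (m%:R : R) `^ k%:R = m%:R `^ (k%:R * (1 - d)) * m%:R `^ (k%:R * d).
    rewrite -powRD; last by rewrite (gt_eqF m0) implybT.
    by congr (_ `^ _); ring.
  rewrite ler_wpM2r ?powR_ge0 //; near: m; apply: near_powR_ge.
    by rewrite mulr_gt0 // subr_gt0.
  exact: powR_gt0.
have deg_ge : m%:R `^ kap / B <= degree R m k a M.
  rewrite /degree; apply: le_trans (_ : M%:R / (8 ^ k * m ^ a)%:R <= _);
    last first.
    rewrite ler_wpM2l // lef_pV2 ?posrE ?ltr0n ?muln_gt0 ?expn_gt0
      ?(ltnW n_gt1) ?(leq_trans _ m6) //.
    by rewrite ler_nat leq_mul2l leq_exp2r ?leq_div ?orbT.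
  have m_pos : (0 < m)%N by apply: leq_trans m6.
  rewrite natrM (natrX _ m) ler_pdivlMr ?mulr_gt0 ?exprn_gt0 ?ltr0n ?expn_gt0
    //.
  apply: le_trans M_ge; rewrite -(powR_mulrn _ (ler0n _ m)).
  have -> : k%:R * d = kap + a%:R by rewrite subrK.
  rewrite powRD; last by rewrite (gt_eqF m0) implybT.
  apply: eq_lerW; rewrite /B; field.
  by rewrite pnatr_eq0 expn_eq0.
have degree_ge1 : 1 <= degree R m k a M.
  apply: le_trans deg_ge; rewrite ler_pdivlMr // mul1r.
  by near: m; apply: near_powR_ge.
have lower := model_prob_ge j n_gt1 kE a_gt0 c_gt0 c_le_a M_le degree_ge1.
have upper := model_prob_le1 m k d (fun G => property_T R G).
rewrite ger0_norm ?subr_ge0 //.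
have {lower} : 1 - model_prob m k d (fun G => property_T R G) <= C / m%:R.
  rewrite lerBlDr -lerBlDl; apply: le_trans lower; rewrite lerD2l lerN2.
  have mk0 : 0 < (m%:R : R) `^ kap by apply: powR_gt0.
  have d0 : 0 < degree R m k a M by apply: lt_le_trans degree_ge1.
  apply: le_trans (_ : 28 * (m%:R ^+ a) * moment_const R q *
      (100 * B / m%:R `^ kap) ^+ q <= _).
    apply: ler_pM; rewrite ?mulr_ge0 ?moment_const_ge0 ?exprn_ge0 ?divr_ge0
      ?(ltW d0) //.
      by rewrite ler_wpM2r ?moment_const_ge0 // ler_wpM2l // -natrX ler_nat
        leq_exp2r ?leq_div.
    apply: lerXn2r; rewrite ?nnegrE ?divr_ge0 ?mulr_ge0 ?(ltW B0) ?(ltW d0)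
      ?(ltW mk0) //.
    have mkB0 : 0 < (m%:R : R) `^ kap / B by apply: divr_gt0.
    by rewrite -mulrA ler_wpM2l // -[B / _]invf_div lef_pV2.
  rewrite expr_div_n /C.
  have -> : 28 * m%:R ^+ a * moment_const R q
    * ((100 * B) ^+ q / m%:R `^ kap ^+ q)
     = C * (m%:R ^+ a / m%:R `^ kap ^+ q).
    by rewrite /C; field; rewrite expf_neq0 ?gt_eqF.
  rewrite ler_wpM2l // ler_pdivrMr ?exprn_gt0 // mulrC ler_pdivlMr //.
  rewrite -exprSr -(powR_mulrn _ (ler0n _ m)) -(powR_mulrn _ (powR_ge0 _ _)).
  rewrite -powRrM; apply: ler_powR => //.
  by rewrite -natr1.
move/le_trans; apply; rewrite ler_pdivrMr // mulrC -ler_pdivrMr //.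
by near: m; apply: nbhs_infty_ger.
Unshelve. all: by end_near. Qed.
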